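(* There exists an absolute constant $c>0$ such that the following holds. Let $n\ge2$ be an integer and $L,\sigma,\Delta,\varepsilon>0$; set $\alpha=\min\{1,\frac{(\sqrt3+1)n\sigma}{30L},\frac{n}{180}\}$ and assume $\varepsilon^2\le\frac{\Delta L\alpha}{81648\,n}$. Then for every PIFO algorithm $\mathcal{A}$ whose proximal parameters satisfy $1/\gamma_t>\sigma$ for all $t$, there exist the dimension $d=\lfloor\frac{\Delta L\sqrt\alpha}{40824\,n\varepsilon^2}\rfloor+1$ and functions $f_1,\dots,f_n:\mathbb{R}^d\to\mathbb{R}$, each $(-\sigma,L)$-smooth, such that $f=\frac1n\sum_i f_i$ satisfies $f(x_0)-\inf_x f(x)\le\Delta$ ($x_0$ the initial point of $\mathcal{A}$) and the iterates of $\mathcal{A}$ satisfy $\mathbb{E}\|\nabla f(x_t)\|_2\ge\varepsilon$ for all integers $0\le t\le c\,\frac{\Delta L\sqrt\alpha}{\varepsilon^2}$. That is, $\mathcal{A}$ needs $\Omega(\Delta L\sqrt\alpha/\varepsilon^2)$ queries to find $\hat x$ with $\mathbb{E}\|\nabla f(\hat x)\|_2<\varepsilon$.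
   Context: A differentiable $g:\mathbb{R}^d\to\mathbb{R}$ is $(l,L)$-smooth ($l\in\mathbb{R}$, $L>0$) if for all $x,y$: $\frac l2\|x-y\|_2^2\le g(x)-g(y)-\langle\nabla g(y),x-y\rangle\le\frac L2\|x-y\|_2^2$. For $\gamma>0$, $\mathrm{prox}^{\gamma}_g(x)=\arg\min_u\{g(u)+\frac{1}{2\gamma}\|x-u\|_2^2\}$ (for $(-\sigma,L)$-smooth $g$ and $1/\gamma>\sigma$ this objective is strongly convex so the prox is well defined). PIFO algorithm: given $f_1,\dots,f_n$ and $f=\frac1n\sum_if_i$, $\mathcal{A}$ is specified by a probability vector $(p_1,\dots,p_n)$, an initial point $x_0$ and parameters $\gamma_t>0$; it draws indices $i_1,i_2,\dots$ independently with $\mathbb{P}(i_t=j)=p_j$, at step $t\ge1$ queries $h_f(x_{t-1},i_t,\gamma_t)=[f_{i_t}(x_{t-1}),\nabla f_{i_t}(x_{t-1}),\mathrm{prox}^{\gamma_t}_{f_{i_t}}(x_{t-1})]$, and outputs $x_t\in\mathrm{span}\{x_0,\dots,x_{t-1},\nabla f_{i_1}(x_0),\dots,\nabla f_{i_t}(x_{t-1}),\mathrm{prox}^{\gamma_1}_{f_{i_1}}(x_0),\dots,\mathrm{prox}^{\gamma_t}_{f_{i_t}}(x_{t-1})\}$ (the choice within the span may depend on all observed information). Iterate $x_t$ uses $t$ queries. *)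

(* Defs.v *)
From Stdlib Require Import Reals.
From mathcomp Require Import all_boot.
Set Implicit Arguments. Unset Strict Implicit. Unset Printing Implicit Defensive.
Local Open Scope R_scope.

Definition vec (d : nat) := 'I_d -> R.
Definition vadd d (u v : vec d) : vec d := fun j => u j + v j.
Definition vsub d (u v : vec d) : vec d := fun j => u j - v j.
Definition inner d (u v : vec d) : R := \big[Rplus/0]_(j < d) (u j * v j).
Definition vnorm d (u : vec d) : R := sqrt (inner u u).

Definition has_gradient d (f : vec d -> R) (g : vec d -> vec d) : Prop :=
  forall x eps, 0 < eps -> exists delta, 0 < delta /\
    forall h, vnorm h < delta ->
      Rabs (f (vadd x h) - f x - inner (g x) h) <= eps * vnorm h.

Definition smooth_lL d (l L : R) (f : vec d -> R) (g : vec d -> vec d) : Prop :=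
  has_gradient f g /\
  forall x y,
    l / 2 * (vnorm (vsub x y)) ^ 2 <= f x - f y - inner (g y) (vsub x y)
    <= L / 2 * (vnorm (vsub x y)) ^ 2.

(* u = prox^gamma_f(x): u minimizes  f(u) + 1/(2 gamma) ||x - u||^2
   (the minimizer is unique under the hypotheses where it is used). *)
Definition is_prox d (f : vec d -> R) (gamma : R) (x u : vec d) : Prop :=
  forall v, f u + / (2 * gamma) * (vnorm (vsub x u)) ^ 2
            <= f v + / (2 * gamma) * (vnorm (vsub x v)) ^ 2.

(* One PIFO oracle answer as observed by the algorithm:
   the drawn index i_t, f_{i_t}(x_{t-1}), grad f_{i_t}(x_{t-1}),
   prox^{gamma_t}_{f_{i_t}}(x_{t-1}). *)
Record answer (n d : nat) := Answer {
  a_idx : 'I_n; a_val : R; a_grad : vec d; a_prox : vec d }.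

(* A PIFO algorithm: probability vector, initial point, prox parameters
   gamma_t (t >= 1), and a rule choosing x_t from the observed history
   of the first t answers (t >= 1). *)
Record pifo (n d : nat) := Pifo {
  p_prob : 'I_n -> R;
  p_x0 : vec d;
  p_gamma : nat -> R;
  p_next : seq (answer n d) -> vec d }.

Definition cur n d (A : pifo n d) (h : seq (answer n d)) : vec d :=
  if h is [::] then p_x0 A else p_next A h.

(* the vectors spanning the allowed choices for x_t after history h of size t:
   x_0, ..., x_{t-1}, the t gradients and the t prox points *)
Definition span_list n d (A : pifo n d) (h : seq (answer n d)) : seq (vec d) :=
  [seq cur A (take k h) | k <- iota 0 (size h)]
  ++ [seq a_grad a | a <- h] ++ [seq a_prox a | a <- h].

Definition in_span d (s : seq (vec d)) (v : vec d) : Prop :=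
  exists c : nat -> R, forall j,
    v j = \big[Rplus/0]_(k < size s) (c k * (nth (fun _ => 0) s k) j).

Definition pifo_valid n d (sigma : R) (A : pifo n d) : Prop :=
  (forall i, 0 <= p_prob A i) /\
  \big[Rplus/0]_(i < n) p_prob A i = 1 /\
  (forall t, (1 <= t)%nat -> 0 < p_gamma A t /\ sigma < / p_gamma A t) /\
  (forall h, h <> [::] -> in_span (span_list A h) (p_next A h)).

(* History produced when the drawn indices are r in REVERSE order
   (head of r = most recent index). Step t uses gamma_t. *)
Fixpoint hist n d (A : pifo n d) (F : 'I_n -> vec d -> R)
    (G : 'I_n -> vec d -> vec d) (P : 'I_n -> R -> vec d -> vec d)
    (r : seq 'I_n) : seq (answer n d) :=
  match r with
  | [::] => [::]
  | i :: r' =>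
      let h := hist A F G P r' in
      let x := cur A h in
      rcons h (Answer i (F i x) (G i x) (P i (p_gamma A (size r').+1) x))
  end.

Definition iterate n d (A : pifo n d) F G P (s : seq 'I_n) : vec d :=
  cur A (hist A F G P (rev s)).

Definition expect n t (p : 'I_n -> R) (w : t.-tuple 'I_n -> R) : R :=
  \big[Rplus/0]_(s : t.-tuple 'I_n) ((\big[Rmult/1]_(i <- s) p i) * w s).

Definition favg n d (F : 'I_n -> vec d -> R) (x : vec d) : R :=
  / INR n * \big[Rplus/0]_(i < n) F i x.
Definition gavg n d (G : 'I_n -> vec d -> vec d) (x : vec d) : vec d :=
  fun j => / INR n * \big[Rplus/0]_(i < n) G i x j.

(* Main.v *)
Require Import Defs.
From Stdlib Require Import ZArith Reals Lra Psatz.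
From Stdlib Require Import FunctionalExtensionality Classical ClassicalEpsilon.
From HB Require Import structures.
From mathcomp Require Import all_boot.
Set Implicit Arguments. Unset Strict Implicit. Unset Printing Implicit Defensive.
Local Open Scope R_scope.

(** The hard instance is a chain of m coordinates z_0, ..., z_{m-1} whose average energy is
      (sqrt alpha / 2) (z_0 - 1)^2 + (1/2) sum_k (z_{k+1} - z_k)^2 + 32 alpha sum_k Phi(z_k),
    with z_m = 0 and Phi a piecewise quadratic well at 1 which is also stationary at 0. Each
    quadratic link belongs to a single component, and consecutive links belong to different
    ones, so that a component splits into blocks of at most two coordinates; neither its
    gradient nor its proximal map can then reveal more than the next coordinate, and only the
    component owning the next link reveals it. The links alternate between two indices of
    probability at most 2/n, so the expected progress after t queries is at most 2t/n.

    As long as z_{m-1} = 0 the gradient has norm at least alpha^(3/4) / 24: after the last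
    coordinate above 1/2 the derivative of Phi is -|z|, and pairing the gradient with a
    weight W that varies on the length scale alpha^(-1/2) and satisfies |W''| <= 32 alpha W
    leaves only a boundary term of order sqrt alpha.

    Iterates lie in a linear span containing the initial point x0, so translating x0 to the
    origin is not legitimate. Instead a Householder reflection sends x0 to the last axis of
    R^(m+1), and the functions ignore that axis. *)

(** * Finite sums and inner products *)

HB.instance Definition _ := Monoid.isComLaw.Build R 0 Rplus
  (fun x y z => Logic.eq_sym (Rplus_assoc x y z)) Rplus_comm Rplus_0_l.
HB.instance Definition _ := Monoid.isComLaw.Build R 1 Rmult
  (fun x y z => Logic.eq_sym (Rmult_assoc x y z)) Rmult_comm Rmult_1_l.

Lemma sumR_scal (I : Type) (r : seq I) (P : pred I) (a : R) (F : I -> R) :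
  a * \big[Rplus/0]_(i <- r | P i) F i = \big[Rplus/0]_(i <- r | P i) (a * F i).
Proof. by apply: big_morph => [x y|]; ring. Qed.

Lemma sumR_add (I : Type) (r : seq I) (P : pred I) (F G : I -> R) :
  \big[Rplus/0]_(i <- r | P i) F i + \big[Rplus/0]_(i <- r | P i) G i =
  \big[Rplus/0]_(i <- r | P i) (F i + G i).
Proof. by rewrite big_split. Qed.

Lemma sumR_recr (n : nat) (F : nat -> R) :
  \big[Rplus/0]_(i < n.+1) F i = \big[Rplus/0]_(i < n) F i + F n.
Proof. by rewrite big_ord_recr. Qed.

Lemma sumR_le (I : Type) (r : seq I) (P : pred I) (F G : I -> R) :
  (forall i, P i -> F i <= G i) ->
  \big[Rplus/0]_(i <- r | P i) F i <= \big[Rplus/0]_(i <- r | P i) G i.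
Proof.
move=> FG; elim/big_rec2: _ => [|i x y Pi xy]; first lra.
by have := FG i Pi; lra.
Qed.

Lemma sumR_ge0 (I : Type) (r : seq I) (P : pred I) (F : I -> R) :
  (forall i, P i -> 0 <= F i) -> 0 <= \big[Rplus/0]_(i <- r | P i) F i.
Proof.
by move=> F0; elim/big_rec: _ => [|i x Pi xy]; [lra | have := F0 i Pi; lra].
Qed.

Lemma sumR_const (n : nat) (a : R) : \big[Rplus/0]_(i < n) a = INR n * a.
Proof.
elim: n => [|n IH]; first by rewrite big_ord0 /=; ring.
by rewrite big_ord_recr /= IH -/(INR n.+1) S_INR; ring.
Qed.

Lemma sumR_delta (n : nat) (k : 'I_n) (a : R) :
  \big[Rplus/0]_(i < n) (if i == k then a else 0) = a.
Proof. by rewrite -big_mkcond big_pred1_eq. Qed.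

Lemma Un_cv_sum (n : nat) (a : 'I_n -> nat -> R) (l : 'I_n -> R) :
  (forall j, Un_cv (a j) (l j)) ->
  Un_cv (fun k => \big[Rplus/0]_(j < n) a j k) (\big[Rplus/0]_(j < n) l j).
Proof.
elim: n a l => [|n IH] a l al.
  have -> : (fun k => \big[Rplus/0]_(j < 0) a j k) = (fun=> 0).
    by apply: functional_extensionality => k; rewrite big_ord0.
  rewrite big_ord0 => e e0; exists 0%N => k _.
  by rewrite /Rdist Rminus_0_r Rabs_R0.
rewrite big_ord_recr /=.
have -> : (fun k => \big[Rplus/0]_(j < n.+1) a j k) =
          (fun k => \big[Rplus/0]_(j < n) a (widen_ord (leqnSn n) j) k + a ord_max k).
  by apply: functional_extensionality => k; rewrite big_ord_recr.
by apply: CV_plus => //; apply: IH.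
Qed.

Lemma innerC d (u v : vec d) : inner u v = inner v u.
Proof. by apply: eq_bigr => j _; ring. Qed.

Lemma inner_lin d (a b : R) (u v w : vec d) :
  inner (fun j => a * u j + b * v j) w = a * inner u w + b * inner v w.
Proof.
rewrite /inner !sumR_scal sumR_add.
by apply: eq_bigr => j _; ring.
Qed.

Lemma inner_linr d (a b : R) (u v w : vec d) :
  inner w (fun j => a * u j + b * v j) = a * inner w u + b * inner w v.
Proof. by rewrite innerC inner_lin !(innerC w). Qed.

Lemma vsubE d (u v : vec d) : vsub u v = fun j => 1 * u j + (-1) * v j.
Proof. by apply: functional_extensionality => j; rewrite /vsub; ring. Qed.

Lemma inner_ge0 d (u : vec d) : 0 <= inner u u.
Proof. by apply: sumR_ge0 => j _; nra. Qed.

Lemma coord_sq_le d (u : vec d) j : u j ^ 2 <= inner u u.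
Proof.
rewrite /inner (bigD1 j) //=.
have: 0 <= \big[Rplus/0]_(i < d | i != j) (u i * u i) by apply: sumR_ge0 => i _; nra.
suff sq a b : 0 <= b -> a ^ 2 <= a * a + b by apply: sq.
by move=> ?; nra.
Qed.

Lemma vnorm_sq d (u : vec d) : vnorm u ^ 2 = inner u u.
Proof. by rewrite /vnorm pow2_sqrt //; apply: inner_ge0. Qed.

Lemma vnorm_ge0 d (u : vec d) : 0 <= vnorm u.
Proof. exact: sqrt_pos. Qed.

Lemma inner_eq0 d (u : vec d) : inner u u = 0 -> forall j, u j = 0.
Proof. by move=> u0 j; have := coord_sq_le u j; rewrite u0; nra. Qed.

Lemma cauchy_schwarz d (u v : vec d) : inner u v ^ 2 <= inner u u * inner v v.
Proof.
case: (Req_dec (inner v v) 0) => [v0|v0].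
  have -> : inner u v = 0.
    by rewrite /inner big1 // => j _; rewrite (inner_eq0 v0); ring.
  by rewrite v0; lra.
have vp : 0 < inner v v by have := inner_ge0 v; lra.
have := inner_ge0 (fun j => inner v v * u j + (- inner u v) * v j).
rewrite inner_lin !inner_linr (innerC v u) => H.
suff: 0 <= inner v v * (inner u u * inner v v - inner u v ^ 2) by nra.
by nra.
Qed.

(** Here [p] acts as a subgradient and [k] as the modulus of convexity. A minimizing sequence is
    Cauchy, and the subgradient inequality based at its limit shows that the limit attains the
    infimum. *)
Lemma strongly_convex_min d (phi : vec d -> R) (p : vec d -> vec d) (k : R) :
  0 < k ->
  (forall u v, phi v + inner (p v) (vsub u v) + k / 2 * inner (vsub u v) (vsub u v)
               <= phi u) ->
  exists u, forall v, phi u <= phi v.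
Proof.
move=> k0 sc.
pose z : vec d := fun=> 0.
(* Completing the square in the inequality based at the origin bounds [phi] from below. *)
have bd u : phi z - inner (p z) (p z) / (2 * k) <= phi u.
  have := sc u z.
  have -> : vsub u z = u by apply: functional_extensionality => j; rewrite /vsub /z; ring.
  have := inner_ge0 (fun j => 1 * p z j + k * u j).
  rewrite inner_lin !inner_linr (innerC u) => H.
  have E : inner (p z) (p z) / (2 * k) * (2 * k) = inner (p z) (p z) by field; lra.
  by nra.
pose E r := exists u, r = - phi u.
have [M [Mub Mlub]] : {M | is_lub E M}.
  apply: completeness; last by exists (- phi z); exists z.
  by exists (- (phi z - inner (p z) (p z) / (2 * k))) => r [u ->]; have := bd u; lra.
have lo u : - M <= phi u by have := Mub (- phi u) (ex_intro _ u erefl); lra.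
have ap e : 0 < e -> exists u, phi u < - M + e.
  move=> e0; apply: NNPP => no.
  have: is_upper_bound E (M - e).
    move=> r [u ->]; case: (Rle_dec (- phi u) (M - e)) => // nle.
    by case: no; exists u; lra.
  by move/Mlub; lra.
have [ri riE] : exists ri : nat -> R, forall i, ri i = / INR i.+1.
  by exists (fun i => / INR i.+1).
(* This tolerance is chosen so that, by [close], two terms past rank [N] lie within [ri N] of each
   other. *)
pose er i := k / 8 * ri i ^ 2.
have inv0 i : 0 < ri i by rewrite riE; apply: Rinv_0_lt_compat; apply: lt_0_INR; lia.
have er0 i : 0 < er i by apply: Rmult_lt_0_compat; [lra | exact: pow_lt].
have {ap} [us usP] : exists us : nat -> vec d, forall i, phi (us i) < - M + er i.
  exists (fun i => proj1_sig (constructive_indefinite_description _ (ap _ (er0 i)))) => i.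
  by case: constructive_indefinite_description.
have close i l : inner (vsub (us i) (us l)) (vsub (us i) (us l)) <= 4 / k * (er i + er l).
  (* At the midpoint the two linear terms cancel, and the quadratic terms add up to k/4 times the
     squared distance. *)
  pose w : vec d := fun j => / 2 * us i j + / 2 * us l j.
  have Di : vsub (us i) w = fun j => / 2 * us i j + (- / 2) * us l j.
    by apply: functional_extensionality => j; rewrite /vsub /w; field.
  have Dl : vsub (us l) w = fun j => (- / 2) * us i j + / 2 * us l j.
    by apply: functional_extensionality => j; rewrite /vsub /w; field.
  have := sc (us i) w; have := sc (us l) w; rewrite Di Dl vsubE.
  rewrite !inner_lin !inner_linr (innerC (us l)).
  have := lo w; have := usP i; have := usP l.
  set a := inner (us i) (us i); set b := inner (us i) (us l); set c := inner (us l) (us l).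
  move=> h1 h2 h3 h4 h5.
  apply: (Rmult_le_reg_l (k / 4)); first lra.
  have -> : k / 4 * (4 / k * (er i + er l)) = er i + er l by field; lra.
  by nra.
have inv_le N i : (N <= i)%coq_nat -> ri i <= ri N.
  by move=> Ni; rewrite !riE; apply: Rinv_le_contravar; [apply: lt_0_INR; lia | apply: le_INR; lia].
have er_le N i : (N <= i)%coq_nat -> er i <= er N.
  move=> Ni; apply: Rmult_le_compat_l; first lra.
  by apply: pow_incr; split; [apply: Rlt_le | apply: inv_le].
have cauchy j : Cauchy_crit (fun i => us i j).
  move=> e e0.
  have [N [HN N0]] := archimed_cor1 e e0.
  exists N => i l iN lN; rewrite /Rdist.
  have NS : ri N < e.
    rewrite riE; apply: Rle_lt_trans HN; apply: Rinv_le_contravar; first by apply: lt_0_INR.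
    by apply: le_INR; lia.
  have h1 := er_le N i iN; have h2 := er_le N l lN.
  have h3 := coord_sq_le (vsub (us i) (us l)) j.
  have h4 := close i l.
  have h5 : 4 / k * (er i + er l) <= ri N ^ 2.
    have -> : ri N ^ 2 = 4 / k * (k / 8 * ri N ^ 2 + k / 8 * ri N ^ 2).
      by field; lra.
    apply: Rmult_le_compat_l; first by apply: Rlt_le; apply: Rdiv_lt_0_compat; lra.
    exact: Rplus_le_compat.
  have h6 : (us i j - us l j) ^ 2 < e ^ 2.
    by move: h3; rewrite {1}/vsub; have := inv0 N; nra.
  by apply: Rabs_def1; nra.
pose u : vec d := fun j => proj1_sig (R_complete _ (cauchy j)).
have ucv j : Un_cv (fun i => us i j) (u j) by rewrite /u; case: R_complete.
have icv : Un_cv (fun i => inner (p u) (vsub (us i) u)) 0.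
  have -> : 0 = \big[Rplus/0]_(j < d) (p u j * (u j - u j)).
    by rewrite big1 // => j _; ring.
  apply: Un_cv_sum => j; apply: CV_mult.
    by move=> e e0; exists 0%N => i _; rewrite /Rdist Rminus_diag Rabs_R0.
  apply: CV_minus => //.
  by move=> e e0; exists 0%N => i _; rewrite /Rdist Rminus_diag Rabs_R0.
exists u => v; apply: Rle_trans (lo v).
case: (Rle_dec (phi u) (- M)) => // nle; exfalso.
have e0 : 0 < (phi u + M) / 2 by lra.
have [N1 HN1] := icv _ e0.
have e1 : 0 < (phi u + M) / 2 / k by apply: Rdiv_lt_0_compat.
have [N2 [HN2 N20]] := archimed_cor1 _ e1.
pose i := Nat.add N1 N2.
have := HN1 i ltac:(rewrite /i; lia); rewrite /Rdist Rminus_0_r => /Rabs_def2 [h1 h2].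
have h3 := sc (us i) u; have h4 := inner_ge0 (vsub (us i) u); have h5 := usP i.
have h6 : er i <= k * ri i.
  rewrite /er; have := inv0 i.
  have : ri i <= 1.
    by rewrite riE -[X in _ <= X]Rinv_1; apply: Rinv_le_contravar; [lra | apply: (le_INR 1); lia].
  move=> a b; have ab : 0 <= k * ri i by apply: Rmult_le_pos; lra.
  have : 0 <= k * ri i * (1 - ri i) by apply: Rmult_le_pos; lra.
  by nra.
have h7 : ri i < (phi u + M) / 2 / k.
  rewrite riE; apply: Rle_lt_trans HN2; apply: Rinv_le_contravar; first by apply: lt_0_INR.
  by apply: le_INR; rewrite /i; lia.
have h8 : k * ri i < (phi u + M) / 2.
  have -> : (phi u + M) / 2 = k * ((phi u + M) / 2 / k) by field; lra.
  by apply: Rmult_lt_compat_l.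
by nra.
Qed.

(** The penalty contributes curvature 1/gamma, which outweighs the nonconvexity sigma of [f] and
    leaves the modulus 1/gamma - sigma. *)
Lemma prox_exists d (f : vec d -> R) (g : vec d -> vec d) (sigma gamma : R) (x : vec d) :
  (forall x y, - sigma / 2 * (vnorm (vsub x y)) ^ 2 <= f x - f y - inner (g y) (vsub x y)) ->
  0 < gamma -> sigma < / gamma -> exists u, is_prox f gamma x u.
Proof.
move=> sm g0 sg.
apply: (@strongly_convex_min _ _
  (fun u j => 1 * g u j + / gamma * (vsub u x) j) (/ gamma - sigma)); first lra.
move=> u v; have := sm u v; rewrite !vnorm_sq !inner_lin.
rewrite (vsubE u v) (vsubE x u) (vsubE x v) (vsubE v x) !inner_lin !inner_linr.
have -> : / (2 * gamma) = / gamma / 2 by field; lra.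
rewrite (innerC v u) (innerC v x) (innerC u x).
by nra.
Qed.

(** * The chain *)

(** An involutive isometry is its own adjoint, so gradients are pulled back by the same map. *)
Definition linear_involutive_isometry d (H : vec d -> vec d) : Prop :=
  [/\ forall a b u v, H (fun j => a * u j + b * v j) = (fun j => a * H u j + b * H v j),
      forall u v, inner (H u) (H v) = inner u v
    & forall u, H (H u) = u].

Lemma reflection_to_last_axis m (x0 : vec m.+1) :
  exists2 H, linear_involutive_isometry H & forall j, j != ord_max -> H x0 j = 0.
Proof.
pose e : vec m.+1 := fun j => if j == ord_max then 1 else 0.
pose s := vnorm x0.
pose w : vec m.+1 := fun j => 1 * x0 j + (- s) * e j.
have innere u : inner u e = u ord_max.
  rewrite /inner (bigD1 ord_max) //= big1 /e ?eqxx => [|j /negbTE ->]; ring.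
have ss : inner x0 x0 = s ^ 2 by rewrite vnorm_sq.
(* Since [x0] and [s * e] have equal norms, reflecting [x0] in the hyperplane orthogonal to [w]
   subtracts exactly [w] and gives [s * e]. If [w] vanishes, [x0] already lies on the last axis. *)
have ww : inner w w = 2 * inner w x0.
  rewrite /w !inner_lin !inner_linr (innerC e x0) !innere /e eqxx ss; ring.
have wx j : j != ord_max -> w j = x0 j by move=> /negbTE jm; rewrite /w /e jm; ring.
clearbody w; case: (Req_dec (inner w w) 0) => [w0|w0].
  exists id; first by split.
  by move=> j /wx <-; exact: inner_eq0.
exists (fun u j => 1 * u j + (- (2 * inner w u / inner w w)) * w j).
  split.
  - move=> a b u v; apply: functional_extensionality => j.
    by rewrite inner_linr; field.
  - move=> u v; rewrite inner_lin !inner_linr (innerC u w).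
    by field.
  - move=> u; apply: functional_extensionality => j.
    by rewrite inner_linr; field.
move=> j /wx ->; rewrite -ww.
by field.
Qed.

(* Piecewise quadratic stand-in for the usual 120 int_1^x t^2(t-1)/(1+t^2) dt. *)
Definition Phi (x : R) : R :=
  if Rle_lt_dec x 0 then / 4 + x ^ 2 / 2
  else if Rle_lt_dec x (/ 2) then / 4 - x ^ 2 / 2 else (x - 1) ^ 2 / 2.

Definition dPhi (x : R) : R :=
  if Rle_lt_dec x 0 then x else if Rle_lt_dec x (/ 2) then - x else x - 1.

Lemma Phi_ge0 x : 0 <= Phi x.
Proof.
rewrite /Phi; case: Rle_lt_dec => ? /=; [|case: Rle_lt_dec => ? /=]; try nra.
by have := pow2_ge_0 (x - 1); lra.
Qed.

Lemma Phi0 : Phi 0 = / 4.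
Proof. by rewrite /Phi; case: Rle_lt_dec => ? /=; lra. Qed.

Lemma dPhi0 : dPhi 0 = 0.
Proof. by rewrite /dPhi; case: Rle_lt_dec => ? /=; lra. Qed.

Lemma dPhi_le_half x : x <= / 2 -> dPhi x = - Rabs x.
Proof.
move=> xh; rewrite /dPhi; case: Rle_lt_dec => ? /=; first by rewrite Rabs_left1 //; lra.
by case: Rle_lt_dec => ? /=; [rewrite Rabs_right; lra | lra].
Qed.

(** The derivative [dPhi] is continuous with slopes 1, -1, 1 on its three pieces, hence
    1-Lipschitz. *)
Lemma Phi_bregman x y :
  - (x - y) ^ 2 / 2 <= Phi x - Phi y - dPhi y * (x - y) <= (x - y) ^ 2 / 2.
Proof.
have h1 := pow2_ge_0 (x - / 2); have h2 := pow2_ge_0 (y - / 2).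
have h3 := pow2_ge_0 (x - y); have h4 := pow2_ge_0 x; have h5 := pow2_ge_0 y.
rewrite /Phi /dPhi; case: (Rle_lt_dec x 0) => ? /=; case: (Rle_lt_dec y 0) => ? /=;
  try case: (Rle_lt_dec x (/ 2)) => ? /=; try case: (Rle_lt_dec y (/ 2)) => ? /=; split; nra.
Qed.

(* q is the fourth root of alpha. *)
Definition link (q : R) (z : nat -> R) (l : nat) : R :=
  if l is l'.+1 then z l - z l' else q * (z 0%N - 1).

Definition link_coef (q : R) (l : nat) : R := if l is 0%N then q else 1.

Definition dlink (q : R) (u : nat -> R) (l : nat) : R :=
  if l is l'.+1 then u l - u l' else q * u 0%N.

(** The link weights [b] let one formula serve both the components and their average, where [b] is
    constantly 1. Link [m] ties the last coordinate to [z m], which is 0 in every application. *)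
Definition chain_energy (m : nat) (q : R) (b z : nat -> R) : R :=
  \big[Rplus/0]_(l < m.+1) (b l / 2 * link q z l ^ 2) +
  \big[Rplus/0]_(k < m) (32 * q ^ 4 * Phi (z k)).

Definition chain_grad (q : R) (b z : nat -> R) (k : nat) : R :=
  b k * link_coef q k * link q z k - b k.+1 * link q z k.+1 + 32 * q ^ 4 * dPhi (z k).

(** Summation by parts, which turns a sum over links into a sum over coordinates. *)
Lemma sum_dlink q (b u : nat -> R) N :
  \big[Rplus/0]_(l < N.+1) (b l * dlink q u l) =
  \big[Rplus/0]_(k < N) ((b k * link_coef q k - b k.+1) * u k) + b N * link_coef q N * u N.
Proof.
elim: N => [|N IH]; first by rewrite big_ord_recr !big_ord0 /=; ring.
by rewrite big_ord_recr /= IH [in RHS]big_ord_recr /=; ring.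
Qed.

(** Each link is affine with linear part [dlink], so the divergence of its square is exactly
    quadratic. The first-order terms match the gradient after summation by parts. *)
Lemma chain_bregman m q (b z y : nat -> R) :
  z m = 0 -> y m = 0 ->
  chain_energy m q b z - chain_energy m q b y -
    \big[Rplus/0]_(k < m) (chain_grad q b y k * (z k - y k)) =
  \big[Rplus/0]_(l < m.+1) (b l / 2 * dlink q (fun k => z k - y k) l ^ 2) +
  32 * q ^ 4 * \big[Rplus/0]_(k < m) (Phi (z k) - Phi (y k) - dPhi (y k) * (z k - y k)).
Proof.
move=> zm ym; pose u k := z k - y k.
have := sum_dlink q (fun l => b l * link q y l) u m.
have -> : u m = 0 by rewrite /u zm ym; ring.
rewrite Rmult_0_r Rplus_0_r => parts.
have -> : \big[Rplus/0]_(k < m) (chain_grad q b y k * (z k - y k)) =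
   \big[Rplus/0]_(l < m.+1) (b l * link q y l * dlink q u l) +
   \big[Rplus/0]_(k < m) (32 * q ^ 4 * (dPhi (y k) * (z k - y k))).
  rewrite parts sumR_add; apply: eq_bigr => k _.
  by rewrite /chain_grad /u; ring.
have -> : chain_energy m q b z = chain_energy m q b y +
   (\big[Rplus/0]_(l < m.+1) (b l * link q y l * dlink q u l) +
    \big[Rplus/0]_(l < m.+1) (b l / 2 * dlink q u l ^ 2)) +
   \big[Rplus/0]_(k < m) (32 * q ^ 4 * (Phi (z k) - Phi (y k))).
  rewrite /chain_energy.
  have -> : \big[Rplus/0]_(l < m.+1) (b l / 2 * link q z l ^ 2) =
    \big[Rplus/0]_(l < m.+1) (b l / 2 * link q y l ^ 2) +
    (\big[Rplus/0]_(l < m.+1) (b l * link q y l * dlink q u l) +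
     \big[Rplus/0]_(l < m.+1) (b l / 2 * dlink q u l ^ 2)).
    rewrite !sumR_add; apply: eq_bigr => -[[|l] lm] _; rewrite /link /dlink /u /=; field.
  have -> : \big[Rplus/0]_(k < m) (32 * q ^ 4 * Phi (z k)) =
    \big[Rplus/0]_(k < m) (32 * q ^ 4 * Phi (y k)) +
    \big[Rplus/0]_(k < m) (32 * q ^ 4 * (Phi (z k) - Phi (y k))).
    by rewrite sumR_add; apply: eq_bigr => k _ /=; ring.
  ring.
have -> : 32 * q ^ 4 * \big[Rplus/0]_(k < m) (Phi (z k) - Phi (y k) - dPhi (y k) * (z k - y k)) =
  \big[Rplus/0]_(k < m) (32 * q ^ 4 * (Phi (z k) - Phi (y k))) -
  \big[Rplus/0]_(k < m) (32 * q ^ 4 * (dPhi (y k) * (z k - y k))).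
  apply: (Rplus_eq_reg_r (\big[Rplus/0]_(k < m) (32 * q ^ 4 * (dPhi (y k) * (z k - y k))))).
  rewrite sumR_scal sumR_add Rplus_assoc Rplus_opp_l Rplus_0_r.
  by apply: eq_bigr => k _; ring.
rewrite -/u; ring.
Qed.

(** Each square is at most twice the sum of the squares of its two ends, and coordinate k meets only
    the links k and k+1, of total weight at most [N]. The boundary term carries the induction and
    vanishes when [u m = 0]. *)
Lemma sum_dlink_sq_le q N (b u : nat -> R) m :
  0 <= q <= 1 -> (forall l, 0 <= b l) -> (forall l, b l + b l.+1 <= N) ->
  \big[Rplus/0]_(l < m.+1) (b l / 2 * dlink q u l ^ 2) <=
  N * \big[Rplus/0]_(k < m) u k ^ 2 + b m * u m ^ 2.
Proof.
move=> q01 b0 bN; elim: m => [|m IH].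
  rewrite big_ord_recr !big_ord0 /=.
  have := b0 0%N; have : q * q <= 1 by nra.
  have := pow2_ge_0 (u 0%N); set a := u 0%N; set c := b 0%N => ua qq c0.
  have : 0 <= c * a ^ 2 by nra.
  by nra.
rewrite big_ord_recr [X in _ <= N * X + _]big_ord_recr /= Rmult_plus_distr_l.
have := b0 m; have := b0 m.+1; have := bN m.
move: IH; set A := bigop _ _ _; set B := bigop _ _ _.
set a := u m; set c := u m.+1; set p := b m; set r := b m.+1 => IH h1 h2 h3.
have : r / 2 * ((c - a) * ((c - a) * 1)) <= r * (a ^ 2 + c ^ 2).
  by have := pow2_ge_0 (c + a); nra.
have : 0 <= (N - p - r) * a ^ 2 by have := pow2_ge_0 a; nra.
by nra.
Qed.

Lemma chain_bregman_bounds m q N (b z y : nat -> R) :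
  0 <= q <= 1 -> (forall l, 0 <= b l) -> (forall l, b l + b l.+1 <= N) ->
  z m = 0 -> y m = 0 ->
  let D := \big[Rplus/0]_(k < m) (z k - y k) ^ 2 in
  - (16 * q ^ 4) * D <=
  chain_energy m q b z - chain_energy m q b y -
    \big[Rplus/0]_(k < m) (chain_grad q b y k * (z k - y k)) <= (N + 16 * q ^ 4) * D.
Proof.
move=> q01 b0 bN zm ym D; rewrite chain_bregman //.
have q4 : 0 <= q ^ 4 by apply: pow_le; lra.
have := @sum_dlink_sq_le q N b (fun k => z k - y k) m q01 b0 bN.
rewrite -/D zm ym Rminus_diag pow_i; last lia.
have : 0 <= \big[Rplus/0]_(l < m.+1) (b l / 2 * dlink q (fun k => z k - y k) l ^ 2).
  apply: sumR_ge0 => l _; have := b0 l.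
  by have := pow2_ge_0 (dlink q (fun k => z k - y k) l); nra.
set A := bigop _ _ _; set B := bigop _ _ (fun k => BigBody _ _ _ (Phi _ - _ - _)).
have : B <= / 2 * D.
  by rewrite /D sumR_scal; apply: sumR_le => k _; have := Phi_bregman (z k) (y k); lra.
have : - / 2 * D <= B.
  by rewrite /D sumR_scal; apply: sumR_le => k _; have := Phi_bregman (z k) (y k); lra.
by move=> h1 h2 h3 h4; split; nra.
Qed.

Lemma chain_energy_ge0 m q (b z : nat -> R) :
  0 <= q -> (forall l, 0 <= b l) -> 0 <= chain_energy m q b z.
Proof.
move=> q0 b0; apply: Rplus_le_le_0_compat; apply: sumR_ge0 => k _.
  by apply: Rmult_le_pos; [have := b0 k; lra | exact: pow2_ge_0].
by apply: Rmult_le_pos; [have := pow_le q 4 q0; lra | exact: Phi_ge0].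
Qed.

Lemma chain_energy0 m q (b : nat -> R) :
  chain_energy m q b (fun=> 0) = b 0%N / 2 * q ^ 2 + 8 * q ^ 4 * INR m.
Proof.
rewrite /chain_energy big_ord_recl big1 => [|l _] /=; last by ring.
by rewrite Phi0 sumR_const; field.
Qed.

(** Links below [K] are unchanged, links above it become 0, and link [K] has weight 0. Since
    [dPhi 0 = 0], replacing a value z by 0 raises [Phi] by at most z^2/2. *)
Lemma chain_energy_cut m q (b z : nat -> R) K :
  0 <= q -> (forall l, 0 <= b l) -> b K = 0 ->
  let z' k := if (k < K)%N then z k else 0 in
  chain_energy m q b z' <=
  chain_energy m q b z + 16 * q ^ 4 * \big[Rplus/0]_(k < m) (z k - z' k) ^ 2.
Proof.
move=> q0 b0 bK z'; have q4 := pow_le q 4 q0.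
rewrite /chain_energy sumR_scal Rplus_assoc; apply: Rplus_le_compat; last first.
  rewrite sumR_add; apply: sumR_le => k _ /=; rewrite /z'.
  case: ifP => _; first by nra.
  by rewrite Phi0; have := Phi_bregman (z k) 0; rewrite Phi0 dPhi0; nra.
apply: sumR_le => l _; have bl := b0 l.
case: (ltngtP l K) => [lK|lK|->]; last by rewrite bK; lra.
- suff -> : link q z' l = link q z l by lra.
  case: {bl} (nat_of_ord l) lK => [|k] lK /=; rewrite /z' lK //.
  by rewrite (ltn_trans (ltnSn k) lK).
- suff -> : link q z' l = 0 by have := pow2_ge_0 (link q z l); nra.
  case: {bl} (nat_of_ord l) lK => [|k] // lK /=.
  by rewrite /z' !ltnNge (ltnW lK) -ltnS lK /=; ring.
Qed.

(** * Lower bound on the gradient *)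

(* Starts with positive slope and then decays, with |W''| bounded by a multiple of h^2 W. *)
Definition weight (h : R) (j : nat) : R := (2 / (2 + h)) ^ j * (1 - 3 / 4 * (2 / (2 + h)) ^ j).

Lemma ratio_pow h j : 0 < h ->
  0 < (2 / (2 + h)) ^ j <= 1.
Proof.
move=> h0; have r0 : 0 < 2 / (2 + h) by apply: Rdiv_lt_0_compat; lra.
split; first exact: pow_lt.
rewrite -[X in _ <= X](pow1 j); apply: pow_incr; split; first lra.
have E : 2 / (2 + h) * (2 + h) = 2 by field; lra.
by nra.
Qed.

Lemma weight_ge h j : 0 < h -> (2 / (2 + h)) ^ j / 4 <= weight h j.
Proof. by move=> h0; have := ratio_pow j h0; rewrite /weight; nra. Qed.

Lemma weight_second_diff h j : 0 < h <= 1 ->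
  Rabs (weight h j + weight h j.+2 - 2 * weight h j.+1) <= 32 * h ^ 2 * weight h j.+1.
Proof.
move=> h01; have := weight_ge j.+1 (proj1 h01); have := ratio_pow j.+1 (proj1 h01).
set P := _ ^ j.+1 => P01 WP.
have Pj : (2 / (2 + h)) ^ j = P * (1 + h / 2) by rewrite /P /=; field; lra.
pose r := 2 / (2 + h).
have r1 : r * (1 + h / 2) = 1 by rewrite /r; field; lra.
have r01 : 0 < r <= 1 by rewrite /r; have := ratio_pow 1 (proj1 h01); rewrite pow_1.
(* The geometric sequences of ratios r and r^2 have second differences of order h^2, so h^2 P
   factors out. The bracket that remains lies in [-3/4, 1/4], and P is at most four times the
   weight. *)
have -> : weight h j + weight h j.+2 - 2 * weight h j.+1 =
  P * (h ^ 2 * (r / 4 - 3 / 16 * (P * (1 + r) ^ 2))).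
  have PS : (2 / (2 + h)) ^ j.+2 = r * P by [].
  rewrite /weight PS Pj -/P /r; field; lra.
apply: Rle_trans (_ : P * (h ^ 2 * 1) <= _); last by nra.
have P2 : 0 <= P * (1 + r) ^ 2 <= 4 by nra.
rewrite Rabs_mult (Rabs_right P); last lra.
rewrite Rabs_mult (Rabs_right (h ^ 2)); last nra.
apply: Rmult_le_compat_l; first lra.
apply: Rmult_le_compat_l; first nra.
by apply: Rabs_le; lra.
Qed.

(** The weight is at most r^j with r = 2/(2+h), and h r^2 <= 1 - r^2 makes the geometric sum
    telescope. Thus the squared norm of the weight is at most 1/h. *)
Lemma weight_sq_sum h N : 0 < h <= 1 ->
  h * \big[Rplus/0]_(j < N) weight h j.+1 ^ 2 <= 1 - ((2 / (2 + h)) ^ N) ^ 2.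
Proof.
move=> h01; elim: N => [|N IH]; first by rewrite big_ord0 /=; lra.
rewrite big_ord_recr /= Rmult_plus_distr_l.
pose r := 2 / (2 + h).
have r1 : r * (1 + h / 2) = 1 by rewrite /r; field; lra.
have r01 : 0 < r <= 1 by rewrite /r; have := ratio_pow 1 (proj1 h01); rewrite pow_1.
have := ratio_pow N (proj1 h01); move: IH; rewrite /weight /= -/r.
set P := r ^ N; set S := bigop _ _ _ => IH P01.
have rr : r ^ 2 * h <= 1 - r ^ 2 by nra.
have a : 0 <= 1 - 3 / 4 * (r * P) <= 1 by nra.
set c := 1 - 3 / 4 * (r * P) in a *.
have : c * c <= 1 by nra.
have : 0 <= P ^ 2 by nra.
move: IH rr => /= IH rr p2 cc.
have : h * (r * P * c * (r * P * c * 1)) <= P * P * (r * r * h).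
  have -> : h * (r * P * c * (r * P * c * 1)) = (P * P * (r * r * h)) * (c * c) by ring.
  have : 0 <= P * P * (r * r * h) by apply: Rmult_le_pos; nra.
  by nra.
by nra.
Qed.

(* Green's identity for the discrete Laplacian; the remainder is dominated by the
   nonlinear term because W is an approximate eigenvector. *)
Lemma weighted_sum_le (W y : nat -> R) (S : R) (N : nat) :
  (forall j, Rabs (W j + W j.+2 - 2 * W j.+1) <= S * W j.+1) ->
  \big[Rplus/0]_(j < N) (W j.+1 * (2 * y j.+1 - y j - y j.+2 - S * Rabs (y j.+1))) <=
  - W 1%N * y 0%N + W 0%N * y 1%N + W N.+1 * y N - W N * y N.+1.
Proof.
move=> WS; elim: N => [|N IH]; first by rewrite big_ord0; lra.
rewrite (sumR_recr _ (fun j => W j.+1 * (2 * y j.+1 - y j - y j.+2 - S * Rabs (y j.+1)))).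
have : - (W N + W N.+2 - 2 * W N.+1) * y N.+1 <= S * W N.+1 * Rabs (y N.+1).
  apply: Rle_trans (Rle_abs _) _; rewrite Rabs_mult Rabs_Ropp.
  by apply: Rmult_le_compat_r (WS N); exact: Rabs_pos.
by lra.
Qed.

Lemma last_above_half (z : nat -> R) (m : nat) :
  exists a, [/\ (a <= m)%N, forall k, (a <= k < m)%N -> z k <= / 2
              & a = 0%N \/ / 2 < z a.-1].
Proof.
elim: m => [|m [a [am za a0]]]; first by exists 0%N; split=> //; left.
case: (Rle_lt_dec (z m) (/ 2)) => zm; last first.
  exists m.+1; split=> // [k /andP[mk km]|]; last by right.
  by move: (leq_trans km mk); rewrite ltnn.
exists a; split=> // [|k /andP[ak]]; first exact: leqW.
rewrite ltnS leq_eqVlt => /orP[/eqP -> //|km].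
by apply: za; rewrite ak.
Qed.

(** With h = sqrt alpha, pairing the tail of the gradient with the weight gives at most -h/24. The
    squared norm of the weight is at most 1/h, so Cauchy-Schwarz yields h (h/24)^2 = q^6/576. *)
Lemma chain_grad_large m q (z : nat -> R) :
  0 < q <= 1 -> z m = 0 -> z m.+1 = 0 ->
  q ^ 6 / 576 <= \big[Rplus/0]_(k < m.+1) chain_grad q (fun=> 1) z k ^ 2.
Proof.
move=> q01 zm zm1.
have [a [am za a0]] := last_above_half z m.+1.
have {}am : (a <= m)%N.
  move: am; rewrite leq_eqVlt => /orP[/eqP am|//].
  by case: a0; rewrite am //= zm; lra.
pose h := q ^ 2.
have h01 : 0 < h <= 1 by rewrite /h; nra.
(* The tail is shifted by one so that [y 0] is its left neighbour. When the tail starts at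
   coordinate 0, a ghost value encodes the first link, and the gradient has the same Laplacian form
   at every index. *)
pose y j := if j is j'.+1 then z (a + j')%N
            else if a is a'.+1 then z a' else z 0%N + h * (1 - z 0%N).
have [N mN] : exists N, m.+1 = (a + N.+1)%N by exists (m - a)%N; rewrite addnS subnKC.
have mN' : m = (a + N)%N by case: (addnS a N) mN => -> [].
have gy j : (j < N.+1)%N -> chain_grad q (fun=> 1) z (a + j) =
    2 * y j.+1 - y j - y j.+2 - 32 * h ^ 2 * Rabs (y j.+1).
  move=> jN; rewrite /chain_grad dPhi_le_half; last first.
    by apply: za; rewrite leq_addr mN ltn_add2l.
  rewrite /= addnS /h; case: j {jN} => [|j]; last by rewrite !addnS /=; ring.
  by rewrite addn0 /y /h; case: (a) => [|a'] /=; ring.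
have W2 := weighted_sum_le y N.+1 (fun j => weight_second_diff j h01).
have y1 : y 1%N <= / 2.
  by rewrite /= addn0; apply: za; rewrite leqnn mN -[X in (X < _)%N]addn0 ltn_add2l.
have W0 : weight h 0 = / 4 by rewrite /weight /=; field.
pose r := 2 / (2 + h).
have r1 : r * (1 + h / 2) = 1 by rewrite /r; field; lra.
have r01 : 2 / 3 <= r <= 1 by nra.
have W1 : weight h 1 = r * (1 - 3 / 4 * r) by rewrite /weight pow_1.
have W10 : weight h 1 - weight h 0 = h / 2 * r * (3 / 4 * (1 + r) - 1).
  by rewrite W0 W1 /r; field; lra.
have {W2} W2 : \big[Rplus/0]_(j < N.+1) (weight h j.+1 * (2 * y j.+1 - y j - y j.+2
    - 32 * h ^ 2 * Rabs (y j.+1))) <= - (h / 24).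
  apply: Rle_trans W2 _.
  have -> : y N.+1 = 0 by rewrite /= -mN'.
  have -> : y N.+2 = 0 by rewrite /= -mN.
  have W10l : h / 12 <= weight h 1 - weight h 0 by rewrite W10; nra.
  have [y0|->] : / 2 < y 0%N \/ y 0%N = y 1%N + h * (1 - y 1%N).
  - by move: a0; rewrite /y; case: (a) => [|a'] [] //= a0; [right | right | left].
  - by rewrite W0 in W10l *; nra.
  (* In the ghost case the boundary term is affine and nondecreasing in [t], so it suffices to bound
     it at t = 1/2. *)
  rewrite W0 W1 in W10 W10l *; move: y1; set t := y 1%N => y1.
  have : 0 <= (h * (r * (1 - 3 / 4 * r)) - h / 2 * r * (3 / 4 * (1 + r) - 1)) * (/ 2 - t).
    apply: Rmult_le_pos; last lra.
    have -> : h * (r * (1 - 3 / 4 * r)) - h / 2 * r * (3 / 4 * (1 + r) - 1) =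
              h * r * (9 / 8 - 9 / 8 * r) by field.
    by apply: Rmult_le_pos; nra.
  have : 0 <= h * (r * (1 - 3 / 4 * r)) by apply: Rmult_le_pos; nra.
  rewrite -W10; set p := r * (1 - 3 / 4 * r) in W10l *.
  by nra.
pose u : vec N.+1 := fun j => chain_grad q (fun=> 1) z (a + j).
pose w : vec N.+1 := fun j => weight h j.+1.
have uw : inner u w <= - (h / 24).
  apply: Rle_trans W2; right; apply: eq_bigr => j _.
  by rewrite /u /w gy //; ring.
have cs := cauchy_schwarz u w.
have ww : h * inner w w <= 1.
  have := weight_sq_sum N.+1 h01; have := ratio_pow N.+1 (proj1 h01).
  have -> : inner w w = \big[Rplus/0]_(j < N.+1) weight h j.+1 ^ 2.
    by apply: eq_bigr => j _; rewrite /w; ring.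
  by nra.
have uu : inner u u <= \big[Rplus/0]_(k < m.+1) chain_grad q (fun=> 1) z k ^ 2.
  rewrite mN big_split_ord /=.
  have -> : inner u u = \big[Rplus/0]_(i < N.+1) chain_grad q (fun=> 1) z (a + i) ^ 2.
    by apply: eq_bigr => j _; rewrite /u; ring.
  rewrite -[X in X <= _]Rplus_0_l; apply: Rplus_le_compat_r.
  by apply: sumR_ge0 => k _; exact: pow2_ge_0.
apply: Rle_trans uu.
have u0 := inner_ge0 u; have w0 := inner_ge0 w.
have h1 : (h / 24) ^ 2 <= inner u u * inner w w by nra.
have h2 : h * (h / 24) ^ 2 <= inner u u.
  apply: Rle_trans (_ : inner u u * (h * inner w w) <= _); last by nra.
  by nra.
by apply: Rle_trans h2; right; rewrite /h; field.
Qed.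

(** * The components and their locality *)

(* The last coordinate is dropped: it carries the direction of the initial point. *)
Definition chain_coord m (v : vec m.+1) (k : nat) : R :=
  if (k < m)%N then v (inord k) else 0.

Definition chain_vec m (a : nat -> R) : vec m.+1 := fun j => if (j < m)%N then a j else 0.
Arguments chain_vec : clear implicits.

Lemma chain_coord_lin m (a b : R) (u v : vec m.+1) k :
  chain_coord (fun j => a * u j + b * v j) k = a * chain_coord u k + b * chain_coord v k.
Proof. by rewrite /chain_coord; case: ifP => _; ring. Qed.

Lemma chain_coord_vec m a k : (k < m)%N -> chain_coord (chain_vec m a) k = a k.
Proof. by move=> km; rewrite /chain_coord /chain_vec km inordK ?km // ltnS ltnW. Qed.

Lemma inner_chain_vec m a (v : vec m.+1) :
  inner (chain_vec m a) v = \big[Rplus/0]_(k < m) (a k * chain_coord v k).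
Proof.
rewrite /inner big_ord_recr /= {2}/chain_vec ltnn Rmult_0_l Rplus_0_r.
apply: eq_bigr => k _; rewrite /chain_vec /chain_coord /= ltn_ord.
by congr (_ * v _); apply: val_inj; rewrite /= inordK // ltnS ltnW.
Qed.

Lemma sum_chain_coord_sq_le m (v : vec m.+1) :
  \big[Rplus/0]_(k < m) chain_coord v k ^ 2 <= inner v v.
Proof.
rewrite /inner big_ord_recr /= -[X in X <= _]Rplus_0_r.
apply: Rplus_le_compat; last by nra.
right; apply: eq_bigr => k _; rewrite /chain_coord ltn_ord.
have -> : inord k = widen_ord (leqnSn m) k.
  by apply: val_inj; rewrite /= inordK // ltnS ltnW.
by ring.
Qed.

Definition scaled_coord m (H : vec m.+1 -> vec m.+1) (beta : R) (x : vec m.+1) (k : nat) : R :=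
  chain_coord (H x) k / beta.

Definition hard_fun m H (lam beta q : R) (b : nat -> R) (x : vec m.+1) : R :=
  lam * chain_energy m q b (scaled_coord H beta x).

Definition hard_grad m H (lam beta q : R) (b : nat -> R) (x : vec m.+1) : vec m.+1 :=
  H (chain_vec m (fun k => lam / beta * chain_grad q b (scaled_coord H beta x) k)).

Lemma scaled_coord_out m H beta (x : vec m.+1) k : (m <= k)%N -> scaled_coord H beta x k = 0.
Proof. by rewrite /scaled_coord /chain_coord ltnNge => -> /=; rewrite /Rdiv Rmult_0_l. Qed.

Lemma smooth_of_bregman d (sigma L : R) (f : vec d -> R) (g : vec d -> vec d) :
  0 < sigma -> 0 < L ->
  (forall x y, - sigma / 2 * inner (vsub x y) (vsub x y) <= f x - f y - inner (g y) (vsub x y)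
               <= L / 2 * inner (vsub x y) (vsub x y)) ->
  smooth_lL (- sigma) L f g.
Proof.
move=> s0 L0 fg; split; last by move=> x y; rewrite vnorm_sq; exact: fg.
move=> x e e0; exists (e / (sigma + L)).
split; first by apply: Rdiv_lt_0_compat; lra.
move=> h hd; have := fg (vadd x h) x.
have -> : vsub (vadd x h) x = h by apply: functional_extensionality => j; rewrite /vsub /vadd; ring.
rewrite -vnorm_sq => bounds.
have h0 := vnorm_ge0 h.
have : (sigma + L) * vnorm h ^ 2 <= e * vnorm h.
  have -> : e = (sigma + L) * (e / (sigma + L)) by field; lra.
  by rewrite Rmult_assoc; apply: Rmult_le_compat_l; [lra | nra].
have : 0 <= sigma * vnorm h ^ 2 by have := pow2_ge_0 (vnorm h); nra.
have : 0 <= L * vnorm h ^ 2 by have := pow2_ge_0 (vnorm h); nra.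
by move=> *; apply: Rabs_le; lra.
Qed.

Lemma isometry_inner_swap d (H : vec d -> vec d) u v :
  linear_involutive_isometry H -> inner (H u) v = inner u (H v).
Proof. by move=> [_ Hi Hinv]; rewrite -Hi Hinv. Qed.

Lemma isometry_sub d (H : vec d -> vec d) u v :
  linear_involutive_isometry H -> H (vsub u v) = vsub (H u) (H v).
Proof. by move=> [Hl _ _]; rewrite !vsubE Hl. Qed.

(** Dividing coordinates by [beta] and multiplying values by [lam] scales all curvatures by
    lam/beta^2. *)
Lemma hard_smooth m H (lam beta q N sigma L : R) (b : nat -> R) :
  linear_involutive_isometry H ->
  0 < lam -> 0 < beta -> 0 <= q <= 1 -> 0 < sigma -> 0 < L ->
  (forall l, 0 <= b l) -> (forall l, b l + b l.+1 <= N) ->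
  32 * lam * q ^ 4 <= sigma * beta ^ 2 -> lam * (2 * N + 32 * q ^ 4) <= L * beta ^ 2 ->
  smooth_lL (- sigma) L (@hard_fun m H lam beta q b) (hard_grad H lam beta q b).
Proof.
move=> HH lam0 beta0 q01 s0 L0 b0 bN sB LB.
apply: smooth_of_bregman => // x y.
set zx := scaled_coord H beta x; set zy := scaled_coord H beta y.
have zE k : zx k - zy k = chain_coord (vsub (H x) (H y)) k / beta.
  by rewrite vsubE chain_coord_lin /zx /zy /scaled_coord; field; lra.
have -> : inner (hard_grad H lam beta q b y) (vsub x y) =
    lam * \big[Rplus/0]_(k < m) (chain_grad q b zy k * (zx k - zy k)).
  rewrite /hard_grad isometry_inner_swap // isometry_sub // inner_chain_vec sumR_scal.
  by apply: eq_bigr => k _; rewrite zE -/zy; field; lra.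
have := @chain_bregman_bounds m q N b zx zy q01 b0 bN
  (scaled_coord_out _ _ _ (leqnn m)) (scaled_coord_out _ _ _ (leqnn m)).
rewrite /= /hard_fun -/zx -/zy.
set D := \big[Rplus/0]_(k < m) (_ ^ 2); set B := bigop _ _ _.
have D0 : 0 <= D by apply: sumR_ge0 => k _; exact: pow2_ge_0.
have : beta ^ 2 * D <= inner (vsub x y) (vsub x y).
  have <- : inner (vsub (H x) (H y)) (vsub (H x) (H y)) = inner (vsub x y) (vsub x y).
    by rewrite -isometry_sub //; case: HH => _ ->.
  apply: Rle_trans (sum_chain_coord_sq_le _); right.
  by rewrite /D sumR_scal; apply: eq_bigr => k _; rewrite zE; field; lra.
set E := inner _ _; set ex := chain_energy _ _ _ zx; set ey := chain_energy _ _ _ zy => DE [h1 h2].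
have h3 := Rmult_le_compat_l lam _ _ (Rlt_le _ _ lam0) h1.
have h4 := Rmult_le_compat_l lam _ _ (Rlt_le _ _ lam0) h2.
have h5 : 32 * lam * q ^ 4 * D <= sigma * E.
  apply: Rle_trans (_ : sigma * beta ^ 2 * D <= _); first exact: Rmult_le_compat_r.
  by rewrite Rmult_assoc; apply: Rmult_le_compat_l; lra.
have h6 : lam * (2 * N + 32 * q ^ 4) * D <= L * E.
  apply: Rle_trans (_ : L * beta ^ 2 * D <= _); first exact: Rmult_le_compat_r.
  by rewrite Rmult_assoc; apply: Rmult_le_compat_l; lra.
by split; lra.
Qed.

(** The last axis is left unconstrained, so that an initial point reflected onto it counts as level
    0. *)
Definition undiscovered m (H : vec m.+1 -> vec m.+1) (K : nat) (x : vec m.+1) : Prop :=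
  forall k, (K <= k < m)%N -> chain_coord (H x) k = 0.

Lemma undiscovered_scaled m H beta K (x : vec m.+1) k :
  undiscovered H K x -> (K <= k)%N -> scaled_coord H beta x k = 0.
Proof.
move=> xK Kk; case: (leqP m k) => [|km]; first exact: scaled_coord_out.
by rewrite /scaled_coord xK ?Kk // /Rdiv Rmult_0_l.
Qed.

(** Past [K] a coordinate and both its neighbours are 0, and [dPhi 0 = 0]. At [K] itself only link
    [K] could contribute, and its weight is 0. *)
Lemma hard_grad_undiscovered m H (lam beta q : R) (b : nat -> R) K (x : vec m.+1) :
  linear_involutive_isometry H -> b K = 0 ->
  undiscovered H K x -> undiscovered H K (hard_grad H lam beta q b x).
Proof.
move=> [_ _ Hinv] bK xK k /andP[Kk km].
rewrite /hard_grad Hinv chain_coord_vec // /chain_grad.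
have z0 := undiscovered_scaled beta xK.
rewrite z0 // dPhi0 [link _ _ k.+1]/= !z0 //; last exact: leqW.
move: Kk; rewrite leq_eqVlt => /orP[/eqP <-|]; first by rewrite bK; ring.
by case: k km => // k km Kk; rewrite [link _ _ k.+1]/= !z0 // ?leqW //; ring.
Qed.

(* Since the link K is absent, zeroing the coordinates from K on can only lower the link
   energies, and loses less in Phi than the quadratic penalty gives back. *)
Lemma hard_prox_undiscovered m H (lam beta q sigma gamma : R) (b : nat -> R) K (x u : vec m.+1) :
  linear_involutive_isometry H ->
  0 < lam -> 0 < beta -> 0 <= q -> (forall l, 0 <= b l) ->
  32 * lam * q ^ 4 <= sigma * beta ^ 2 -> 0 < gamma -> sigma < / gamma ->
  b K = 0 -> undiscovered H K x ->
  is_prox (hard_fun H lam beta q b) gamma x u -> undiscovered H K u.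
Proof.
move=> HH lam0 beta0 q0 b0 sB g0 sg bK xK ux.
pose w := H u.
pose w' : vec m.+1 := fun j => if (K <= j < m)%N then 0 else w j.
have := ux (H w').
rewrite !vnorm_sq.
have norms v : inner (vsub x v) (vsub x v) = inner (vsub (H x) (H v)) (vsub (H x) (H v)).
  by rewrite -isometry_sub //; case: HH => _ ->.
rewrite !norms; have [_ _ Hinv] := HH; rewrite Hinv -/w.
pose D := inner (vsub w w') (vsub w w').
have HxK (j : 'I_m.+1) : (K <= j < m)%N -> H x j = 0.
  by move=> /andP[Kj jm]; have := xK j; rewrite Kj jm /chain_coord jm inord_val; apply.
have -> : inner (vsub (H x) w) (vsub (H x) w) = inner (vsub (H x) w') (vsub (H x) w') + D.
  rewrite /D /inner sumR_add; apply: eq_bigr => j _; rewrite /vsub /w'.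
  by case: ifP => [/HxK ->|_]; ring.
have coord' k : chain_coord w' k = if (k < K)%N then chain_coord w k else 0.
  rewrite /chain_coord; case km: (k < m)%N; last by case: ifP.
  have kE : (inord k : 'I_m.+1) = k :> nat by rewrite inordK // ltnS ltnW.
  by rewrite /w' kE km andbT; case: leqP.
have cutE : scaled_coord H beta (H w') =
            fun k => if (k < K)%N then scaled_coord H beta u k else 0.
  apply: functional_extensionality => k; rewrite /scaled_coord Hinv coord'.
  by case: ifP => // _; rewrite /Rdiv Rmult_0_l.
have := chain_energy_cut m (scaled_coord H beta u) q0 b0 bK.
rewrite /hard_fun /= cutE; set z' := fun k : nat => _.
set E' := chain_energy _ _ _ z'; set E := chain_energy _ _ _ _; set S := bigop _ _ _ => cut ineq.
have SD : beta ^ 2 * S <= D.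
  apply: Rle_trans (sum_chain_coord_sq_le _); right; rewrite /S sumR_scal.
  apply: eq_bigr => k _; rewrite vsubE chain_coord_lin coord' /z' /scaled_coord -/w.
  by case: ifP => _; field; lra.
have S0 : 0 <= S by apply: sumR_ge0 => k _; exact: pow2_ge_0.
(* Cutting saves D/(2 gamma) in the penalty and costs at most sigma D/2 in the energy. As sigma <
   1/gamma, a minimizer must have D = 0. *)
have D0 : D = 0.
  have D1 : 0 <= D by exact: inner_ge0.
  have h1 := Rmult_le_compat_l lam _ _ (Rlt_le _ _ lam0) cut.
  have h2 : 32 * lam * q ^ 4 * S <= sigma * D.
    have h3 : 32 * lam * q ^ 4 * S <= sigma * beta ^ 2 * S by exact: Rmult_le_compat_r.
    have sp : 0 <= sigma.
      have b2 : 0 < beta ^ 2 by exact: pow_lt.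
      have q4 := pow_le q 4 q0; have : 0 <= 32 * lam * q ^ 4 by apply: Rmult_le_pos; lra.
      by case: (Rle_lt_dec 0 sigma) => // sn; nra.
    have := Rmult_le_compat_l sigma _ _ sp SD; lra.
  have E2 : / (2 * gamma) = / gamma / 2 by field; lra.
  by rewrite E2 in ineq; nra.
move=> k /andP[Kk km]; rewrite -/w.
have kE : (inord k : 'I_m.+1) = k :> nat by rewrite inordK // ltnS ltnW.
have := inner_eq0 D0 (inord k); rewrite /vsub /w' kE Kk km /=.
by rewrite /chain_coord km; lra.
Qed.

Lemma hard_grad_norm m H (lam beta q : R) (x : vec m.+2) :
  linear_involutive_isometry H -> 0 < lam -> 0 < beta -> 0 < q <= 1 ->
  undiscovered H m x ->
  lam / beta * (q ^ 3 / 24) <= vnorm (hard_grad H lam beta q (fun=> 1) x).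
Proof.
move=> HH lam0 beta0 q01 xm.
have lb : 0 < lam / beta by exact: Rdiv_lt_0_compat.
apply: Rsqr_incr_0_var; last exact: vnorm_ge0.
rewrite !Rsqr_pow2 vnorm_sq /hard_grad; case: (HH) => _ -> _; rewrite inner_chain_vec.
have := @chain_grad_large m q (scaled_coord H beta x) q01
  (undiscovered_scaled _ xm (leqnn m)) (scaled_coord_out _ _ _ (leqnn _)).
set S := bigop _ _ _ => Sl.
set T := bigop _ _ _; have -> : T = (lam / beta) ^ 2 * S.
  by rewrite /S sumR_scal; apply: eq_bigr => k _; rewrite chain_coord_vec //; ring.
rewrite Rpow_mult_distr; apply: Rmult_le_compat_l; first exact: pow2_ge_0.
by apply: Rle_trans Sl; right; field.
Qed.

(** * Random progress *)

(* The indices are listed with the most recent one first, as in [hist]. *)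
Fixpoint progress n (owner : nat -> 'I_n) (r : seq 'I_n) : nat :=
  if r is i :: r' then
    let K := progress owner r' in if owner K == i then K.+1 else K
  else 0%N.

Lemma in_span_closed d (V : vec d -> Prop) (s : seq (vec d)) (v : vec d) :
  V (fun=> 0) -> (forall a u w, V u -> V w -> V (fun j => a * u j + 1 * w j)) ->
  (forall i, (i < size s)%N -> V (nth (fun=> 0) s i)) -> in_span s v -> V v.
Proof.
move=> V0 Vl Vs [c cv].
have -> : v = fun j => \big[Rplus/0]_(k < size s) (c k * nth (fun=> 0) s k j).
  exact: functional_extensionality.
move: (size s) Vs => N {cv} Vs; elim: N Vs => [|N IH] Vs.
  suff -> : (fun j => \big[Rplus/0]_(k < 0) (c k * nth (fun=> 0) s k j)) = fun=> 0 by [].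
  by apply: functional_extensionality => j; rewrite big_ord0.
have -> : (fun j => \big[Rplus/0]_(k < N.+1) (c k * nth (fun=> 0) s k j)) =
  fun j => c N * nth (fun=> 0) s N j + 1 * \big[Rplus/0]_(k < N) (c k * nth (fun=> 0) s k j).
  apply: functional_extensionality => j.
  by rewrite (sumR_recr N (fun k => c k * nth (fun=> 0) s k j)); ring.
by apply: Vl; [exact: Vs | apply: IH => i iN; apply: Vs; exact: leqW].
Qed.

Lemma size_hist n d (A : pifo n d) F G P r : size (hist A F G P r) = size r.
Proof. by elim: r => //= i r IH; rewrite size_rcons IH. Qed.

(** The predicates [V K] behave like an increasing chain of subspaces, and only an answer from the
    owner of link [K] can leave [V K]. *)
Lemma iterate_progress n d (sigma : R) (A : pifo n d) F G P (owner : nat -> 'I_n)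
    (V : nat -> vec d -> Prop) :
  pifo_valid sigma A -> V 0%N (p_x0 A) ->
  (forall K, V K (fun=> 0)) ->
  (forall K a u w, V K u -> V K w -> V K (fun j => a * u j + 1 * w j)) ->
  (forall K x, V K x -> V K.+1 x) ->
  (forall K K' i gamma x, 0 < gamma -> sigma < / gamma -> V K x ->
     K' = (if owner K == i then K.+1 else K) -> V K' (G i x) /\ V K' (P i gamma x)) ->
  forall r, V (progress owner r) (cur A (hist A F G P r)).
Proof.
move=> [_ [_ [gam spn]]] V0 Vz Vl VS step r.
(* A new iterate may combine the whole past, so the invariant must cover all earlier iterates,
   gradients and proximal points. *)
suff: (forall k, (k <= size r)%N -> V (progress owner r) (cur A (take k (hist A F G P r)))) /\
      (forall k, (k < size r)%N ->
         V (progress owner r) (nth (fun=> 0) [seq a_grad a | a <- hist A F G P r] k) /\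
         V (progress owner r) (nth (fun=> 0) [seq a_prox a | a <- hist A F G P r] k)).
  by case=> /(_ _ (leqnn _)); rewrite -{1}(size_hist A F G P r) take_size.
elim: r => [|i r [IHx IHa]]; first by split=> // k; rewrite leqn0 => /eqP ->.
set h := hist A F G P r in IHx IHa *; have sh : size h = size r by exact: size_hist.
set K := progress owner r in IHx IHa *.
have -> : progress owner (i :: r) = if owner K == i then K.+1 else K by [].
set K' := if _ then _ else _.
have KK x : V K x -> V K' x by rewrite /K'; case: ifP => // _; exact: VS.
rewrite [hist _ _ _ _ _]/= -/h.
set a := Answer _ _ _ _.
have Vx : V K (cur A h) by have := IHx _ (leqnn _); rewrite -{1}sh take_size.
have [g0 sg] := gam (size r).+1 isT.
have [VG VP] := step K K' i _ _ g0 sg Vx erefl.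
have Va k : (k < (size r).+1)%N ->
    V K' (nth (fun=> 0) [seq a_grad a | a <- rcons h a] k) /\
    V K' (nth (fun=> 0) [seq a_prox a | a <- rcons h a] k).
  rewrite ltnS leq_eqVlt !map_rcons !nth_rcons !size_map sh => /orP[/eqP ->|kr].
    by rewrite ltnn eqxx.
  by rewrite kr; have [? ?] := IHa k kr; split; exact: KK.
have Vold k : (k <= size r)%N -> V K' (cur A (take k (rcons h a))).
  move=> kr; rewrite -cats1 takel_cat ?sh //.
  by apply: KK; exact: IHx.
split=> // k; rewrite leq_eqVlt => /orP[/eqP ->|]; last exact: Vold.
have sh' : size (rcons h a) = (size r).+1 by rewrite size_rcons sh.
rewrite -[size (i :: r)]sh' take_size.
have ne : rcons h a <> [::] by case: (h).
have -> : cur A (rcons h a) = p_next A (rcons h a) by case: (rcons h a) ne.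
apply: (in_span_closed (Vz K') (Vl K') _ (spn _ ne)) => j.
rewrite /span_list !size_cat !size_map size_iota sh' => jlt.
rewrite nth_cat size_map size_iota; case: ltnP => [j1|j1].
  by rewrite (nth_map 0%N) ?size_iota ?sh' // nth_iota // add0n; exact: Vold.
rewrite nth_cat size_map sh'; case: ltnP => [j2|j2]; first by case: (Va _ j2).
by case: (Va (j - (size r).+1 - (size r).+1)%N) => //; rewrite !ltn_subLR.
Qed.

Lemma expect_le n t (p : 'I_n -> R) (w w' : t.-tuple 'I_n -> R) :
  (forall i, 0 <= p i) -> (forall s, w s <= w' s) -> expect p w <= expect p w'.
Proof.
move=> p0 ww; apply: sumR_le => s _; apply: Rmult_le_compat_l => //.
by elim/big_rec: _ => [|i x _ x0]; [lra | exact: Rmult_le_pos].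
Qed.

Lemma expect_affine n t (p : 'I_n -> R) (a b : R) (w : t.-tuple 'I_n -> R) :
  expect p (fun s => a + b * w s) = a * @expect n t p (fun=> 1) + b * expect p w.
Proof. by rewrite /expect !sumR_scal sumR_add; apply: eq_bigr => s _; ring. Qed.

(** Independent identically distributed draws have a reversible law. This reconciles the draw order
    of [iterate] with the most-recent-first order of [progress]. *)
Lemma expect_rev n t (p : 'I_n -> R) (w : seq 'I_n -> R) :
  expect p (fun s : t.-tuple 'I_n => w (rev s)) = expect p (fun s : t.-tuple 'I_n => w s).
Proof.
rewrite /expect [RHS](reindex_inj (h := fun s : t.-tuple 'I_n => [tuple of rev s])) /=; last first.
  by move=> s s' /(congr1 val) /= /(can_inj revK) /val_inj.
by apply: eq_bigr => s _; congr (_ * _); apply: perm_big; rewrite perm_sym perm_rev.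
Qed.

Lemma expect_cons n t (p : 'I_n -> R) (w : seq 'I_n -> R) :
  expect p (fun s : t.+1.-tuple 'I_n => w s) =
  \big[Rplus/0]_(i < n) (p i * expect p (fun s : t.-tuple 'I_n => w (i :: s))).
Proof.
under eq_bigr => i _ do rewrite /expect sumR_scal.
rewrite pair_bigA /expect (reindex (fun x : 'I_n * t.-tuple 'I_n => [tuple of x.1 :: x.2])) /=.
  by apply: eq_bigr => -[i s] _ /=; rewrite big_cons Rmult_assoc.
exists (fun s => (thead s, [tuple of behead s])) => [[i s] _|s _] /=.
  by congr (_, _); apply: val_inj.
by rewrite [RHS]tuple_eta.
Qed.

Lemma expect_nil n (p : 'I_n -> R) (w : 0.-tuple 'I_n -> R) : expect p w = w [tuple].
Proof.
rewrite /expect (big_pred1 [tuple]) /= => [|s]; first by rewrite big_nil; ring.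
by apply/esym/eqP; exact: tuple0.
Qed.

Lemma expect1 n t (p : 'I_n -> R) :
  \big[Rplus/0]_(i < n) p i = 1 -> @expect n t p (fun=> 1) = 1.
Proof.
move=> p1; elim: t => [|t IH]; first by rewrite expect_nil.
rewrite (expect_cons t p (fun=> 1)) IH -[RHS]p1.
by apply: eq_bigr => i _; ring.
Qed.

(** Given the earlier draws, the latest one advances the progress by 1 with probability
    [p (owner K)], which is at most [c]. *)
Lemma expect_progress n t (p : 'I_n -> R) (owner : nat -> 'I_n) (c : R) :
  (forall i, 0 <= p i) -> \big[Rplus/0]_(i < n) p i = 1 -> (forall K, p (owner K) <= c) ->
  expect p (fun s : t.-tuple 'I_n => INR (progress owner s)) <= INR t * c.
Proof.
move=> p0 p1 pc; elim: t => [|t IH]; first by rewrite expect_nil /=; lra.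
rewrite (expect_cons t p (fun s => INR (progress owner s))).
have -> : \big[Rplus/0]_(i < n)
     (p i * expect p (fun s : t.-tuple 'I_n => INR (progress owner (i :: s)))) =
   expect p (fun s : t.-tuple 'I_n => p (owner (progress owner s)) + 1 * INR (progress owner s)).
  rewrite /expect; under eq_bigr => i _ do rewrite sumR_scal.
  rewrite exchange_big; apply: eq_bigr => s _ /=.
  set K := progress owner s; set Q := bigop _ _ _.
  have -> : p (owner K) + 1 * INR K =
      \big[Rplus/0]_(i < n) ((if i == owner K then p (owner K) else 0) + INR K * p i).
    by rewrite -sumR_add sumR_delta -sumR_scal p1; ring.
  rewrite sumR_scal; apply: eq_bigr => i _; rewrite eq_sym.
  case: eqP => [->|_]; first by rewrite S_INR; ring.
  by ring.
apply: Rle_trans (_ : c * 1 + 1 * (INR t * c) <= _); last by rewrite S_INR; lra.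
apply: Rle_trans (_ : expect p (fun s : t.-tuple 'I_n => c + 1 * INR (progress owner s)) <= _).
  by apply: expect_le => // s; have := pc (progress owner s); lra.
by rewrite expect_affine expect1 //; lra.
Qed.

(** If all indices but one exceeded 2/n, the total would be greater than 2(n-1)/n, which is at least
    1. Excluding first an arbitrary index and then the one found gives two. *)
Lemma two_unlikely_indices n (p : 'I_n -> R) :
  (2 <= n)%N -> (forall i, 0 <= p i) -> \big[Rplus/0]_(i < n) p i = 1 ->
  exists i0 i1, [/\ i0 != i1, p i0 <= 2 / INR n & p i1 <= 2 / INR n].
Proof.
move=> n2 p0 p1.
have n0 : 0 < INR n by apply: lt_0_INR; apply/ltP; exact: ltnW.
have n2R : 2 <= INR n by apply: (le_INR 2); apply/leP.
suff other i : exists j, j != i /\ p j <= 2 / INR n.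
  have [i [_ pi]] := other (Ordinal (ltnW n2)).
  by have [j [ji pj]] := other i; exists j, i.
apply: NNPP => no.
have lo j : (if j == i then 0 else 2 / INR n) <= p j.
  case: eqP => [_|/eqP ji]; first exact: p0.
  by case: (Rle_lt_dec (p j) (2 / INR n)) => [pj|]; [case: no; exists j | lra].
have [j ji] : exists j, j != i.
  exists (if i == Ordinal n2 then Ordinal (ltnW n2) else Ordinal n2).
  by case: (eqVneq i (Ordinal n2)) => [->|]; rewrite // eq_sym.
have pj : 2 / INR n < p j.
  by case: (Rle_lt_dec (p j) (2 / INR n)) => // pj; case: no; exists j.
have : \big[Rplus/0]_(k < n) ((if k == j then p j - 2 / INR n else 0) +
          (2 / INR n + (-1) * (if k == i then 2 / INR n else 0))) <= \big[Rplus/0]_(k < n) p k.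
  apply: sumR_le => k _; have := lo k; case: (eqVneq k j) => [->|_].
    by rewrite (negbTE ji); lra.
  by case: (k == i); lra.
rewrite -!sumR_add -sumR_scal !sumR_delta sumR_const p1.
have -> : INR n * (2 / INR n) = 2 by field; lra.
have : 2 / INR n <= 1.
  have : 2 / INR n * INR n = 2 by field; lra.
  by nra.
by lra.
Qed.

(** * The lower bound *)

Lemma undiscovered_le m H K K' (x : vec m.+1) :
  (K <= K')%N -> undiscovered H K x -> undiscovered H K' x.
Proof. by move=> KK xK k /andP[Kk km]; apply: xK; rewrite (leq_trans KK Kk). Qed.

Lemma undiscovered_lin m H K a b (u v : vec m.+1) :
  linear_involutive_isometry H -> undiscovered H K u -> undiscovered H K v ->
  undiscovered H K (fun j => a * u j + b * v j).
Proof. by move=> [Hl _ _] uK vK k kK; rewrite Hl chain_coord_lin uK ?vK //; ring. Qed.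

Lemma linear_zero d (H : vec d -> vec d) :
  linear_involutive_isometry H -> H (fun=> 0) = fun=> 0.
Proof.
move=> [Hl _ _]; have := Hl 0 0 (fun=> 0) (fun=> 0).
have -> : (fun _ : 'I_d => 0 * 0 + 0 * 0) = fun=> 0 by apply: functional_extensionality => j; ring.
by move=> ->; apply: functional_extensionality => j; ring.
Qed.

Lemma linear_sum d (H : vec d -> vec d) (I : Type) (r : seq I) (u : I -> vec d) :
  linear_involutive_isometry H ->
  H (fun j => \big[Rplus/0]_(i <- r) u i j) = fun j => \big[Rplus/0]_(i <- r) H (u i) j.
Proof.
move=> HH; elim: r => [|i r IH].
  have -> : (fun j => \big[Rplus/0]_(i <- [::]) u i j) = fun=> 0.
    by apply: functional_extensionality => j; rewrite big_nil.
  by rewrite linear_zero //; apply: functional_extensionality => j; rewrite big_nil.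
have -> : (fun j => \big[Rplus/0]_(k <- i :: r) u k j) =
          fun j => 1 * u i j + 1 * \big[Rplus/0]_(k <- r) u k j.
  by apply: functional_extensionality => j; rewrite big_cons; ring.
have [Hl _ _] := HH; rewrite Hl IH.
by apply: functional_extensionality => j; rewrite big_cons; ring.
Qed.

(** * Distribution of the links among the components *)

Definition owner n (i0 i1 : 'I_n) (l : nat) : 'I_n := if odd l then i1 else i0.

(** The value n compensates the average over components, in which every link then has weight 1. *)
Definition link_weight n (i0 i1 i : 'I_n) (l : nat) : R :=
  if i == owner i0 i1 l then INR n else 0.

Lemma link_weight_ge0 n (i0 i1 i : 'I_n) l : 0 <= link_weight i0 i1 i l.
Proof. by rewrite /link_weight; case: ifP => _; [exact: pos_INR | lra]. Qed.

Lemma owner_succ n (i0 i1 : 'I_n) l : i0 != i1 -> owner i0 i1 l.+1 != owner i0 i1 l.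
Proof. by move=> i01; rewrite /owner /=; case: odd => //; rewrite eq_sym. Qed.

Lemma link_weight_disjoint n (i0 i1 i : 'I_n) l :
  i0 != i1 -> link_weight i0 i1 i l + link_weight i0 i1 i l.+1 <= INR n.
Proof.
move=> /(owner_succ l) i01; rewrite /link_weight; have := pos_INR n.
case: eqP => [->|_]; last by case: ifP => _; lra.
by rewrite eq_sym (negbTE i01); lra.
Qed.

Lemma sum_link_weight n (i0 i1 : 'I_n) l : \big[Rplus/0]_(i < n) link_weight i0 i1 i l = INR n.
Proof. exact: sumR_delta. Qed.

Lemma gavg_hard m n H lam beta q (i0 i1 : 'I_n) (x : vec m.+1) :
  linear_involutive_isometry H -> 0 < INR n ->
  gavg (fun i => hard_grad H lam beta q (link_weight i0 i1 i)) x =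
  hard_grad H lam beta q (fun=> 1) x.
Proof.
move=> HH n0; rewrite /hard_grad; set z := scaled_coord H beta x.
have -> : chain_vec m (fun k => lam / beta * chain_grad q (fun=> 1) z k) =
  fun j => / INR n * (\big[Rplus/0]_(i < n)
      chain_vec m (fun k => lam / beta * chain_grad q (link_weight i0 i1 i) z k) j) + 0 * 0.
  apply: functional_extensionality => j; rewrite /chain_vec.
  case: ifP => _; last by rewrite big1 //; ring.
  have -> : \big[Rplus/0]_(i < n) (lam / beta * chain_grad q (link_weight i0 i1 i) z j) =
    \big[Rplus/0]_(i < n) (lam / beta * link_coef q j * link q z j * link_weight i0 i1 i j +
      ((- (lam / beta * link q z j.+1)) * link_weight i0 i1 i j.+1 +
       lam / beta * (32 * q ^ 4 * dPhi (z j)))).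
    by apply: eq_bigr => i _; rewrite /chain_grad; ring.
  rewrite -!sumR_add -!sumR_scal !sum_link_weight sumR_const /chain_grad.
  by set c := lam / beta; field; lra.
have [Hl _ _] := HH; rewrite (Hl _ 0 _ (fun=> 0)) linear_sum //.
by apply: functional_extensionality => j; rewrite /gavg Rmult_0_l Rplus_0_r.
Qed.

Lemma pifo_lower_bound n m (L sigma q lam beta : R) (A : pifo n m.+2) :
  (2 <= n)%N -> 0 < L -> 0 < sigma -> 0 < lam -> 0 < beta -> 0 < q <= 1 ->
  32 * lam * q ^ 4 <= sigma * beta ^ 2 ->
  lam * (2 * INR n + 32 * q ^ 4) <= L * beta ^ 2 ->
  pifo_valid sigma A ->
  exists (F : 'I_n -> vec m.+2 -> R) (G : 'I_n -> vec m.+2 -> vec m.+2)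
         (P : 'I_n -> R -> vec m.+2 -> vec m.+2),
    (forall i, smooth_lL (- sigma) L (F i) (G i)) /\
    (forall i gamma x, 0 < gamma -> sigma < / gamma -> is_prox (F i) gamma x (P i gamma x)) /\
    (forall x, favg F (p_x0 A) - favg F x <= lam * (q ^ 2 / 2 + 8 * q ^ 4 * INR m.+1)) /\
    (forall t : nat,
       lam / beta * (q ^ 3 / 24) * (1 - 2 * INR t / (INR n * INR m.+1)) <=
       expect (p_prob A) (fun s : t.-tuple 'I_n => vnorm (gavg G (iterate A F G P s)))).
Proof.
move=> n2 L0 s0 lam0 beta0 q01 sB LB valid.
have [p0 [p1 _]] := valid.
have n0 : 0 < INR n by apply: lt_0_INR; apply/ltP; exact: ltnW.
have m0 : 0 < INR m.+1 by apply: lt_0_INR; apply/ltP.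
have q0 : 0 <= q <= 1 by lra.
have [i0 [i1 [i01 pi0 pi1]]] := two_unlikely_indices n2 p0 p1.
have [H HH Hx0] := reflection_to_last_axis (p_x0 A).
pose b := link_weight i0 i1; pose own := owner i0 i1.
have b0 i l : 0 <= b i l by exact: link_weight_ge0.
pose F i : vec m.+2 -> R := hard_fun H lam beta q (b i).
pose G i : vec m.+2 -> vec m.+2 := hard_grad H lam beta q (b i).
(* Choice of a minimizer; the value is arbitrary where none exists. *)
pose P i gamma (x : vec m.+2) : vec m.+2 :=
  epsilon (inhabits (fun=> 0)) (is_prox (F i) gamma x).
have smooth i : smooth_lL (- sigma) L (F i) (G i).
  by apply: (@hard_smooth _ H lam beta q (INR n)) => // l; exact: link_weight_disjoint.
have prox i gamma x : 0 < gamma -> sigma < / gamma -> is_prox (F i) gamma x (P i gamma x).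
  move=> g0 sg; apply: epsilon_spec; apply: (@prox_exists _ _ (G i) sigma) => // u v.
  by case: (smooth i) => _ /(_ u v) [].
have x0K : undiscovered H 0 (p_x0 A).
  move=> k km; rewrite /chain_coord; case: ifP => // km'; apply: Hx0.
  by rewrite -val_eqE /= inordK ?neq_ltn ?km' // ltnW.
exists F, G, P; split=> //; split=> //; split.
  move=> x.
  have Fx i : 0 <= F i x.
    by apply: Rmult_le_pos; [lra | apply: chain_energy_ge0 => //; lra].
  have : 0 <= favg F x.
    by apply: Rmult_le_pos; [apply: Rlt_le; exact: Rinv_0_lt_compat | exact: sumR_ge0].
  suff -> : favg F (p_x0 A) = lam * (q ^ 2 / 2 + 8 * q ^ 4 * INR m.+1) by lra.
  have z0 : scaled_coord H beta (p_x0 A) = fun=> 0.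
    by apply: functional_extensionality => k; exact: undiscovered_scaled x0K _.
  rewrite /favg /F /hard_fun z0.
  under eq_bigr => i _ do rewrite chain_energy0.
  have -> : \big[Rplus/0]_(i < n) (lam * (b i 0%N / 2 * q ^ 2 + 8 * q ^ 4 * INR m.+1)) =
            \big[Rplus/0]_(i < n) (lam * q ^ 2 / 2 * b i 0%N + lam * 8 * q ^ 4 * INR m.+1).
    by apply: eq_bigr => i _; field.
  by rewrite -sumR_add -sumR_scal sum_link_weight sumR_const; field; lra.
move=> t; pose g := lam / beta * (q ^ 3 / 24).
have g0 : 0 <= g.
  apply: Rmult_le_pos; first by apply: Rlt_le; exact: Rdiv_lt_0_compat.
  by have := pow_le q 3 (proj1 q0); lra.
have inv r : undiscovered H (progress own r) (cur A (hist A F G P r)).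
  apply: (@iterate_progress n _ sigma A F G P own (undiscovered H)) => //.
  - by move=> K k _; rewrite linear_zero // /chain_coord; case: ifP.
  - by move=> K a u w; exact: undiscovered_lin.
  - by move=> K x; apply: undiscovered_le.
  move=> K K' i gamma x gam0 sg xK K'E.
  (* If [i] owns link [K], the level rises to K+1 and the next link belongs to the other index.
     Otherwise link [K] is absent from component [i]. *)
  have bK' : b i K' = 0.
    rewrite K'E /b /link_weight; case oK: (own K == i).
      rewrite -(eqP oK).
      by rewrite eq_sym (negbTE (owner_succ _ i01)).
    by rewrite eq_sym oK.
  have xK' : undiscovered H K' x.
    by apply: undiscovered_le xK; rewrite K'E; case: ifP.
  split; first exact: hard_grad_undiscovered.
  apply: (hard_prox_undiscovered HH lam0 beta0 (proj1 q0) (b0 i) sB gam0 sg bK' xK').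
  exact: prox.
have ownp K : p_prob A (own K) <= 2 / INR n by rewrite /own /owner; case: odd.
have Ek := expect_progress t p0 p1 ownp.
rewrite -(expect_rev t _ (fun s => INR (progress own s))) in Ek.
(* The affine function g (1 - K/(m+1)) is at most g, which bounds the gradient while K <= m, and is
   nonpositive afterwards. Its expectation needs only the mean progress. *)
apply: Rle_trans (_ : expect (p_prob A) (fun s : t.-tuple 'I_n =>
    g + (- (g / INR m.+1)) * INR (progress own (rev s))) <= _); last first.
  apply: expect_le => // s.
  rewrite gavg_hard //; set K := progress own _.
  case: (leqP K m) => Km; last first.
    have : INR m.+1 <= INR K by apply: le_INR; apply/leP.
    have := vnorm_ge0 (hard_grad H lam beta q (fun=> 1) (iterate A F G P s)).
    have -> : g + - (g / INR m.+1) * INR K = g / INR m.+1 * (INR m.+1 - INR K) by field; lra.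
    have : 0 <= g / INR m.+1 by apply: Rmult_le_pos => //; apply: Rlt_le; exact: Rinv_0_lt_compat.
    move=> h1 h2 h3; apply: Rle_trans h2.
    by have := Rmult_le_pos _ (INR K - INR m.+1) h1; lra.
  apply: Rle_trans (_ : g <= _).
    have := pos_INR K; have : 0 <= g / INR m.+1.
      by apply: Rmult_le_pos => //; apply: Rlt_le; exact: Rinv_0_lt_compat.
    by move=> h1 h2; have := Rmult_le_pos _ _ h1 h2; lra.
  apply: hard_grad_norm => //.
  by apply: undiscovered_le Km _; exact: inv.
rewrite expect_affine expect1 // -/g.
have gm : 0 <= g / INR m.+1 by apply: Rmult_le_pos => //; apply: Rlt_le; exact: Rinv_0_lt_compat.
have := Rmult_le_compat_l _ _ _ gm Ek.
have -> : g / INR m.+1 * (INR t * (2 / INR n)) = g * (2 * INR t / (INR n * INR m.+1)) by field; lra.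
by lra.
Qed.

Theorem theoremF1 :
  exists c : R, 0 < c /\
  forall (n : nat) (L sigma Delta eps : R),
    (2 <= n)%nat -> 0 < L -> 0 < sigma -> 0 < Delta -> 0 < eps ->
    let alpha := Rmin 1 (Rmin ((sqrt 3 + 1) * INR n * sigma / (30 * L))
                              (INR n / 180)) in
    eps ^ 2 <= Delta * L * alpha / (81648 * INR n) ->
    let d := (Z.to_nat (Int_part (Delta * L * sqrt alpha / (40824 * INR n * eps ^ 2))) + 1)%nat in
    forall A : pifo n d, pifo_valid sigma A ->
    exists (F : 'I_n -> vec d -> R) (G : 'I_n -> vec d -> vec d)
           (P : 'I_n -> R -> vec d -> vec d),
      (forall i, smooth_lL (- sigma) L (F i) (G i)) /\
      (forall i gamma x, 0 < gamma -> sigma < / gamma ->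
          is_prox (F i) gamma x (P i gamma x)) /\
      (forall x, favg F (p_x0 A) - favg F x <= Delta) /\
      (forall t : nat, INR t <= c * (Delta * L * sqrt alpha / eps ^ 2) ->
          eps <= expect (p_prob A)
                   (fun s : t.-tuple 'I_n => vnorm (gavg G (iterate A F G P s)))).
Proof.
(* With [B] the real number whose floor is the chain length, t <= n B/12 suffices, and 12 * 40824 =
   489888 < 500000. *)
exists (/ 500000); split; first lra.
move=> n L sigma Delta eps n2 L0 s0 D0 e0 alpha He d.
have n2R : 2 <= INR n by apply: (le_INR 2); apply/leP.
have sq3 : 0 < sqrt 3 < 9 / 5.
  split; first by apply: sqrt_lt_R0; lra.
  rewrite -(sqrt_Rsqr (9 / 5)); last lra.
  by apply: sqrt_lt_1; rewrite /Rsqr; lra.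
have a1 : alpha <= 1 by exact: Rmin_l.
have a2 : alpha <= (sqrt 3 + 1) * INR n * sigma / (30 * L).
  by apply: Rle_trans (Rmin_r _ _) _; exact: Rmin_l.
have a3 : alpha <= INR n / 180 by apply: Rle_trans (Rmin_r _ _) _; exact: Rmin_r.
have a0 : 0 < alpha.
  apply: Rmin_glb_lt; first lra.
  apply: Rmin_glb_lt; last lra.
  by apply: Rdiv_lt_0_compat; [apply: Rmult_lt_0_compat => //; apply: Rmult_lt_0_compat|]; lra.
pose q := sqrt (sqrt alpha).
have sa0 : 0 < sqrt alpha by exact: sqrt_lt_R0.
have q0 : 0 < q by exact: sqrt_lt_R0.
have q2 : sqrt alpha = q ^ 2 by rewrite /q pow2_sqrt //; lra.
have q4 : alpha = q ^ 4.
  have -> : q ^ 4 = (q ^ 2) ^ 2 by ring.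
  by rewrite -q2 pow2_sqrt //; lra.
have q1 : q <= 1.
  rewrite /q -[X in _ <= X]sqrt_1; apply: sqrt_le_1_alt.
  by rewrite -[X in _ <= X]sqrt_1; apply: sqrt_le_1_alt.
have e2 : 0 < eps ^ 2 by exact: pow_lt.
pose B := Delta * L * q ^ 2 / (40824 * INR n * eps ^ 2).
have den : 0 < 40824 * INR n * eps ^ 2 by apply: Rmult_lt_0_compat; lra.
have BE : B * (40824 * INR n * eps ^ 2) = Delta * L * q ^ 2 by rewrite /B; field; lra.
have He' : 81648 * INR n * eps ^ 2 <= Delta * L * q ^ 4.
  have E : Delta * L * alpha / (81648 * INR n) * (81648 * INR n) = Delta * L * alpha by field; lra.
  rewrite -q4 -E Rmult_comm; apply: Rmult_le_compat_r => //; lra.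
have DL : 0 < Delta * L by exact: Rmult_lt_0_compat.
have B2 : 2 <= B.
  have q24 : Delta * L * q ^ 4 <= Delta * L * q ^ 2.
    by apply: Rmult_le_compat_l; [lra | rewrite -q2 -q4 q2 q4; nra].
  by apply: (Rmult_le_reg_r (40824 * INR n * eps ^ 2)) => //; rewrite BE; lra.
(* The floor of [B] gives the m+1 chain coordinates, and the remaining dimension carries the axis of
   the initial point. The assumption on [eps] gives B >= 2, so the floor is at least B/2. *)
have [m [mE mlo mhi]] : exists m, [/\ d = m.+2, B / 2 <= INR m.+1 & INR m.+1 <= B].
  have := base_Int_part B; rewrite /d q2 -/B.
  set z := Int_part B => -[z1 z2].
  have zp : (2 <= z)%Z by have /lt_IZR : 1 < IZR z; [lra | lia].
  have mz : INR (Z.to_nat z) = IZR z by rewrite INR_IZR_INZ Z2Nat.id //; lia.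
  exists (Z.to_nat z).-1.
  have -> : (Z.to_nat z).-1.+1 = Z.to_nat z by apply: prednK; apply/ltP; lia.
  by rewrite addn1 mz; split=> //; lra.
clearbody d; subst d => A valid.
have q3 : 0 < q ^ 3 by exact: pow_lt.
(* The scale [beta] makes the gradient bound (lam/beta) q^3/24 equal to 3 eps/2. The factor 3n in
   [lam] absorbs 2n + 32 alpha, since alpha <= n/180. *)
pose beta := 108 * INR n * eps / (L * q ^ 3).
have beta0 : 0 < beta.
  by apply: Rdiv_lt_0_compat; apply: Rmult_lt_0_compat => //; lra.
pose lam := L / (3 * INR n) * beta ^ 2.
have b20 : 0 < beta ^ 2 by exact: pow_lt.
have lam0 : 0 < lam by apply: Rmult_lt_0_compat => //; apply: Rdiv_lt_0_compat; lra.
have sB : 32 * lam * q ^ 4 <= sigma * beta ^ 2.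
  have -> : 32 * lam * q ^ 4 = (32 * L * alpha / (3 * INR n)) * beta ^ 2.
    by rewrite q4 /lam; field; lra.
  apply: Rmult_le_compat_r; first lra.
  apply: (Rmult_le_reg_r (3 * INR n)); first lra.
  have -> : 32 * L * alpha / (3 * INR n) * (3 * INR n) = 32 * L * alpha by field; lra.
  (* With sqrt 3 + 1 < 14/5 the required constant is 32 * (14/5) / 90 < 1. *)
  have h : alpha * (30 * L) <= (sqrt 3 + 1) * INR n * sigma.
    have <- : (sqrt 3 + 1) * INR n * sigma / (30 * L) * (30 * L) = (sqrt 3 + 1) * INR n * sigma.
      by field; lra.
    by apply: Rmult_le_compat_r; lra.
  have : 0 < INR n * sigma by apply: Rmult_lt_0_compat; lra.
  by nra.
have LB : lam * (2 * INR n + 32 * q ^ 4) <= L * beta ^ 2.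
  rewrite -q4 /lam.
  have -> : L * beta ^ 2 = L / (3 * INR n) * beta ^ 2 * (3 * INR n) by field; lra.
  by apply: Rmult_le_compat_l; [exact: Rlt_le | lra].
have [F [G [P [sm [px [gap low]]]]]] :=
  pifo_lower_bound n2 L0 s0 lam0 beta0 (conj q0 q1) sB LB valid.
exists F, G, P; split=> //; split=> //; split.
  move=> x; apply: Rle_trans (gap x) _.
  have -> : lam * (q ^ 2 / 2 + 8 * q ^ 4 * INR m.+1) =
    1944 * (INR n * eps ^ 2) / (L * q ^ 4) + 31104 * (INR n * eps ^ 2 * INR m.+1) / (L * q ^ 2).
    by rewrite /lam /beta; field; lra.
  have Lq2 : 0 < L * q ^ 2 by apply: Rmult_lt_0_compat => //; exact: pow_lt.
  have Lq4 : 0 < L * q ^ 4 by apply: Rmult_lt_0_compat => //; exact: pow_lt.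
  (* The first link is controlled by the assumption on [eps], the wells by m+1 <= B. The two shares
     of [Delta] add up to less than 1. *)
  have h1 : 1944 * (INR n * eps ^ 2) / (L * q ^ 4) <= Delta / 40.
    apply: (Rmult_le_reg_r (L * q ^ 4)) => //.
    have -> : 1944 * (INR n * eps ^ 2) / (L * q ^ 4) * (L * q ^ 4) = 1944 * (INR n * eps ^ 2).
      by field; lra.
    by lra.
  have h2 : 31104 * (INR n * eps ^ 2 * INR m.+1) / (L * q ^ 2) <= Delta * (31104 / 40824).
    apply: (Rmult_le_reg_r (L * q ^ 2)) => //.
    have -> : 31104 * (INR n * eps ^ 2 * INR m.+1) / (L * q ^ 2) * (L * q ^ 2) =
              31104 * (INR n * eps ^ 2 * INR m.+1) by field; lra.
    have ne : 0 <= INR n * eps ^ 2 by apply: Rmult_le_pos; lra.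
    by have := Rmult_le_compat_l _ _ _ ne mhi; lra.
  by lra.
move=> t; rewrite q2 => ht; apply: Rle_trans (low t).
have -> : lam / beta * (q ^ 3 / 24) = 3 / 2 * eps.
  by rewrite /lam /beta; field; lra.
have mp : 0 < INR m.+1 by lra.
have nm : 0 < INR n * INR m.+1 by apply: Rmult_lt_0_compat; lra.
(* A loss of one third brings 3 eps/2 down to exactly eps. *)
suff h : 2 * INR t / (INR n * INR m.+1) <= 1 / 3 by nra.
apply: (Rmult_le_reg_r (INR n * INR m.+1)) => //.
have -> : 2 * INR t / (INR n * INR m.+1) * (INR n * INR m.+1) = 2 * INR t by field; lra.
have tB : INR t <= 40824 / 500000 * (INR n * B).
  apply: Rle_trans ht _; right; rewrite /B; field; lra.
have : INR n * (B / 2) <= INR n * INR m.+1 by apply: Rmult_le_compat_l; lra.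
by have : 0 <= INR n * B; [apply: Rmult_le_pos; lra | lra].
Qed.
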